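(* Let $P$ be a regular polygon with an even number $d\ge6$ of sides. Let $f\in\mathcal R_1^k$ be an odd function such that $f'>0$, $\lambda(f)\le1/2$ and $f\left(\delta\frac{2\pi}d\right)\le\delta f\left(\frac{2\pi}d\right)$ for every $0\le\delta\le1$. Then there exists a positive constant $C$ such that every orbit of $\Phi_f$ having more than $C$ collisions between parallel sides belongs to the basin of attraction of $\mathcal P$, the set of all periodic points of period two of the billiard map $\Phi_f$.
   Context: Billiard map. Let $P\subset\mathbb R^2$ be the compact region bounded by a polygon (here with sides of unit length) with vertices $C_1,\dots,C_d$; let $\zeta:[0,|\partial P|]\to\mathbb R^2$ be the positively oriented arclength parametrization of $\partial P$, with $\zeta(\tilde s_i)=C_i$, $0=\tilde s_1<\dots<\tilde s_d<\tilde s_{d+1}=|\partial P|$ and $\zeta(|\partial P|)=\zeta(0)$. Put $M=(0,|\partial P|)\times(-\pi/2,\pi/2)$ and $V=\{\tilde s_1,\dots,\tilde s_{d+1}\}\times(-\pi/2,\pi/2)$. For $x=(s,\theta)\in M\setminus V$ let $q(x)=\zeta(s)$, let $v(x)$ be the unit vector such that the oriented angle formed by $\zeta'(s)$ and $v(x)$ is $\pi/2-\theta$, let $t(x)=\sup\{\tau>0: (q(x),q(x)+\tau v(x))\subset P\}$ (open segment), and $q_1(x)=q(x)+t(x)v(x)$. Let $S_1^+=\bigcup_i\overline{q_1^{-1}(C_i)}$ and $N_1^+=\partial M\cup V\cup S_1^+$. For $x\in M\setminus N_1^+$ let $s_1(x)=\zeta^{-1}(q_1(x))$, $\bar v_1(x)=-v(x)+2\langle\zeta'(s_1(x)),v(x)\rangle\zeta'(s_1(x))$,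 $\bar\theta_1(x)=\arcsin\langle\zeta'(s_1(x)),\bar v_1(x)\rangle$. The billiard map with reflection law $f:(-\pi/2,\pi/2)\to(-\pi/2,\pi/2)$ is $\Phi_f:M\setminus N_1^+\to M$, $\Phi_f(x)=(s_1(x),f(\bar\theta_1(x)))$. Put $N_{j+1}^+=N_j^+\cup\Phi_f^{-1}(N_j^+)$, $N_\infty^+=\bigcup_{j\ge1}N_j^+$. Elements $(s,\theta)$ of $M\setminus V$ are called collisions; $(s,\theta)$ occurs at the side containing $\zeta(s)$. Reflection laws. $\lambda(f)=\sup_{(-\pi/2,\pi/2)}|f'|$; $\mathcal R_1^k$, $k\ge1$, is the set of $C^k$ embeddings $f:(-\pi/2,\pi/2)\to(-\pi/2,\pi/2)$ with $f(0)=0$ and $\lambda(f)<1$. The basin of attraction of $\mathcal P$ is the set of $x\in M\setminus N_\infty^+$ with $\operatorname{dist}(\Phi_f^n(x),\mathcal P)\to0$ as $n\to+\infty$ (Euclidean distance on $M$).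
   Formalization: ''More than C collisions between parallel sides'' is taken as more than C consecutive ones, for full forward orbits that avoid the singular set: with a total count the claim fails, e.g. d = 6, f(θ) = θ/2 has a periodic orbit outside the basin in which every third flight is between parallel sides. *)

(* Defs.v *)
From mathcomp Require Import all_boot all_order all_algebra.
From mathcomp Require Import all_classical all_reals all_analysis.

Set Implicit Arguments.
Unset Strict Implicit.
Unset Printing Implicit Defensive.

Import Order.TTheory GRing.Theory Num.Theory.
Import numFieldNormedType.Exports.

Local Open Scope classical_set_scope.
Local Open Scope ring_scope.

(* The norm that the library puts on [R * R] is the max norm (same topology),
   hence the explicit Euclidean notions. *)
Definition dot (R : realType) (u v : R * R) : R := u.1 * v.1 + u.2 * v.2.

Definition cross (R : realType) (u v : R * R) : R := u.1 * v.2 - u.2 * v.1.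

Definition enorm (R : realType) (u : R * R) : R := Num.sqrt (dot u u).

(* Counterclockwise rotation: the oriented angle from [u] to [rot a u] is [a]. *)
Definition rot (R : realType) (a : R) (u : R * R) : R * R :=
  (cos a * u.1 - sin a * u.2, sin a * u.1 + cos a * u.2).

(* The value is [+oo] when [A] is empty. *)
Definition edist (R : realType) (x : R * R) (A : set (R * R)) : \bar R :=
  ereal_inf [set (enorm (x - p))%:E | p in A].

(* A polygon with [d] sides is given by the [d]-periodic sequence
   [c : nat -> R * R] of its vertices in positive order: the vertices
   C_1, ..., C_d are [c 0], ..., [c d.-1]. *)

Definition side (R : realType) (c : nat -> R * R) (i : nat) : R * R :=
  c i.+1 - c i.

(* Unit sides, and at each vertex a left turn by the exterior angle 2 pi / d
   (interior angle (d - 2) pi / d). *)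
Definition regular_polygon (R : realType) (d : nat) (c : nat -> R * R) : Prop :=
  [/\ forall i, c (i + d)%N = c i,
      forall i, enorm (side c i) = 1
    & forall i, side c i.+1 = rot (2 * pi / d%:R) (side c i)].

(* Arclength parametrization of a polygon with unit sides, to be used on
   [0, d]; the parameter of the vertex [c i] is [i], and the perimeter is [d]. *)
Definition zeta (R : realType) (c : nat -> R * R) (s : R) : R * R :=
  let i := Num.truncn s in c i + (s - i%:R) *: side c i.

Definition bdry (R : realType) (d : nat) (c : nat -> R * R) : set (R * R) :=
  zeta c @` `[0, d%:R].

(* The boundary curve together with the bounded components of its
   complement. *)
Definition region (R : realType) (d : nat) (c : nat -> R * R) : set (R * R) :=
  bdry d c `|`
  [set p | (~` bdry d c) p /\
           bounded_set (connected_component (~` bdry d c) p)].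

Definition angles (R : realType) : set R := `]- (pi / 2), pi / 2[%classic.
Arguments angles {R}.

Definition phase (R : realType) (d : nat) : set (R * R) :=
  `]0, d%:R[%classic `*` angles.

Definition vertex_lines (R : realType) (d : nat) : set (R * R) :=
  [set i%:R | i in [set i : nat | (i <= d)%N]] `*` angles.

Section Billiard.
Context (R : realType) (d : nat) (c : nat -> R * R).
Implicit Types x : R * R.

Definition position x : R * R := zeta c x.1.

Definition velocity x : R * R := rot (pi / 2 - x.2) (derive1 (zeta c) x.1).

Definition flight_time x : R :=
  sup [set tau | 0 < tau /\
         forall r, 0 < r < tau -> region d c (position x + r *: velocity x)].

Definition hit x : R * R := position x + flight_time x *: velocity x.

(* S_1^+ *)
Definition corner_set : set (R * R) :=
  [set x | exists2 i, (i < d)%N &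
     closure [set y : R * R | (phase d `\` vertex_lines d) y /\ hit y = c i] x].

Definition phase_boundary : set (R * R) :=
  closure (phase d) `\` interior (phase d).

(* N_1^+ *)
Definition singular1 : set (R * R) :=
  phase_boundary `|` vertex_lines d `|` corner_set.

Definition billiard_dom : set (R * R) := phase d `\` singular1.

(* zeta^{-1} (q_1 x); [zeta] is injective on [0, d] up to zeta 0 = zeta d, and
   q_1 x is not a vertex when [billiard_dom x]. *)
Definition hit_param x : R := get [set s : R | 0 <= s <= d%:R /\ zeta c s = hit x].

Definition reflected x : R * R :=
  let e := derive1 (zeta c) (hit_param x) in
  - velocity x + (2 * dot e (velocity x)) *: e.

Definition hit_angle x : R :=
  asin (dot (derive1 (zeta c) (hit_param x)) (reflected x)).

Variable f : R -> R.

(* Phi_f; only meaningful on [billiard_dom]. *)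
Definition billiard_map x : R * R := (hit_param x, f (hit_angle x)).

(* [singular j] is N_{j+1}^+. *)
Fixpoint singular (j : nat) : set (R * R) :=
  if j is j'.+1 then
    singular j' `|` (billiard_dom `&` billiard_map @^-1` singular j')
  else singular1.

Definition singular_oo : set (R * R) := \bigcup_j singular j.

Definition regular_points : set (R * R) := phase d `\` singular_oo.

Definition period_two : set (R * R) :=
  [set x | [/\ billiard_dom x, billiard_dom (billiard_map x),
               billiard_map x <> x & billiard_map (billiard_map x) = x]].

Definition basin (A : set (R * R)) : set (R * R) :=
  [set x | regular_points x /\
           edist (iter n billiard_map x) A @[n --> \oo] --> 0%E].

Definition orbit_of x : set (R * R) := [set iter n billiard_map x | n in setT].

(* The side at which the collision [x] occurs: for i < x.1 < i + 1, the point
   [zeta c x.1] lies on the side from [c i] to [c i.+1]. *)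
Definition side_index x : nat := Num.truncn x.1.

Definition between_parallel_sides x : Prop :=
  cross (side c (side_index x)) (side c (side_index (billiard_map x))) = 0.

(* Collisions between parallel sides are counted consecutively. Their total
   number along the orbit would not do: for d = 6 and f(theta) = theta / 2 there
   is a periodic orbit, disjoint from the basin, in which every third collision
   is followed by one at the parallel side. *)
Definition consecutive_parallel x (n : nat) : Prop :=
  exists m : nat, forall j : nat, (j < n)%N ->
    between_parallel_sides (iter (m + j) billiard_map x).

End Billiard.

Definition lambda (R : realType) (f : R -> R) : \bar R :=
  ereal_sup [set `|derive1 f t|%:E | t in angles].

Definition Ck_on (R : realType) (k : nat) (A : set R) (f : R -> R) : Prop :=
  (forall j t, (j < k)%N -> A t -> derivable (derive1n j f) t 1) /\
  (forall j t, (j <= k)%N -> A t -> {for t, continuous (derive1n j f)}).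

(* Immersion that is a homeomorphism onto its image. *)
Definition Ck_embedding (R : realType) (k : nat) (A : set R) (f : R -> R) :
    Prop :=
  [/\ Ck_on k A f,
      forall t, A t -> derive1 f t <> 0
    & exists g : R -> R, (forall t, A t -> g (f t) = t) /\
                         {within f @` A, continuous g}].

(* R_1^k *)
Definition contracting_law (R : realType) (k : nat) (f : R -> R) : Prop :=
  [/\ forall t, angles t -> angles (f t),
      Ck_embedding k angles f,
      f 0 = 0
    & (lambda f < 1)%E].

(* Main.v *)
Require Import Defs.
From mathcomp Require Import all_boot all_order all_algebra.
From mathcomp Require Import all_classical all_reals all_analysis.
From mathcomp Require Import ring lra zify.

Set Implicit Arguments.
Unset Strict Implicit.
Unset Printing Implicit Defensive.

Import Order.TTheory GRing.Theory Num.Theory.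
Import numFieldNormedType.Exports.

Local Open Scope classical_set_scope.
Local Open Scope ring_scope.

(** Write [a = 2 pi / d] for the exterior angle and [width = cot (a / 2)] for the
    distance between parallel sides. A flight with angle [theta] from a side to
    the parallel one moves the collision by [width * tan theta] along the
    sides, and the next angle is [- f theta]. As the opposite side is run in
    the opposite direction, a run of such flights drifts always towards the same
    end of the strip, while [f] at least halves the size of the angle. So after
    a long run the angle is tiny. If all later flights are again between
    parallel sides, the angle tends to 0. Otherwise the drift carries the orbit
    past a vertex, and it lands, very close to that vertex, on the side next
    to the parallel one, from where it leaves with an angle close to [f a].

    The point is what follows this exit. In the limit where the angle vanishes,
    the orbit starts at the end of a side, drifting outwards with angle
    [f a <= a / 2], so it exits a second time and lands at distance
    [width * sin (f a) / cos (a - f a) >= width * tan (f a)] from the end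
    towards which it drifts, leaving with angle [f (a - f a)]. Put
    [mu = f a / a <= 1 / 2]. The condition on [f] says that [f t <= mu * t] on
    [0 <= t <= a]. Hence [f (a - f a) <= (1 - mu) * f a], the later angles
    decrease at least like powers of [mu], and since [tan] is convex the drift
    still to come is at most [width * tan ((1 - mu) * f a) / (1 - mu)]. By
    strict convexity this is less than [width * tan (f a)]: the available room
    is never used up, and the orbit stays between two parallel sides for ever.
    The inequality being strict, it persists by continuity when the angle
    before the first exit is small enough ([exit_margin], [exit_twice]), and the
    inequality [width * tan phi < (1 - mu) * w] between the angle and the room
    left is invariant ([trapped_step]).

    So the angle tends to 0 in every case. As all points [(s, 0)] with [s] not
    a vertex have period two, the distance of a collision to the points of
    period two is at most the size of its angle, and the orbit is attracted
    ([halving_basin]).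

    To compute flights, the region bounded by the polygon is identified with an
    intersection of half-planes ([region_polygon]); a flight then ends at the
    first point where it leaves one of these half-planes ([hitE]). *)

(** * Frames and vertices of the regular polygon *)

Lemma pair_scaleE (R : realType) (k : R) (u : R * R) :
  k *: u = (k * u.1, k * u.2).
Proof. by []. Qed.

(** The quarter turn, [rot (pi / 2)]. *)
Definition perp (R : realType) (u : R * R) : R * R := (- u.2, u.1).

Ltac coords := rewrite /cross /dot /perp /Defs.rot ?pair_scaleE /=.

Lemma pair_eq (R : realType) (u v : R * R) : u.1 = v.1 -> u.2 = v.2 -> u = v.
Proof. by case: u => ? ?; case: v => ? ? /= -> ->. Qed.

Section Geometry.
Context (R : realType) (d : nat) (c : nat -> R * R).
Context (d_ge6 : (6 <= d)%N).

Notation e := (side c).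
Notation turn := (2 * pi / d%:R : R).
Notation half := (pi / d%:R : R).
Notation width := (cos half / sin half).

Let d_gt0 : (0 : R) < d%:R.
Proof. by rewrite ltr0n; lia. Qed.

Lemma turn2 : turn = half + half.
Proof. by field; rewrite gt_eqF. Qed.

Lemma half_turn_gt0 : 0 < half.
Proof. by rewrite divr_gt0 ?pi_gt0. Qed.

Lemma turn_le : turn <= pi / 3.
Proof.
rewrite ler_pdivrMr // mulrAC ler_pdivlMr // -subr_ge0.
have h6 : (6 : R) <= d%:R by rewrite ler_nat.
have -> : pi * d%:R - 2 * pi * 3 = pi * (d%:R - 6) :> R by ring.
by rewrite mulr_ge0 ?pi_ge0 ?subr_ge0.
Qed.

Lemma sin_half_gt0 : 0 < sin half.
Proof.
apply: sin_gt0_pihalf; rewrite half_turn_gt0 /=.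
by have := turn_le; rewrite turn2; have := pi_gt0 R; lra.
Qed.

Lemma cos_half_gt0 : 0 < cos half.
Proof.
apply: cos_gt0_pihalf; have := half_turn_gt0.
by have := turn_le; rewrite turn2; have := pi_gt0 R; lra.
Qed.

(** Oriented towards elimination of the powers of [cos half]: the two rules are
    what [field] needs to decide identities between [half] and [turn]. *)
Lemma cos_half_sq : cos half * cos half = 1 - sin half ^+ 2.
Proof. by rewrite -expr2 cos2sin2. Qed.

Lemma cos_half_cube :
  cos half * (cos half * cos half) = cos half * (1 - sin half ^+ 2).
Proof. by rewrite cos_half_sq. Qed.

Context (Preg : regular_polygon d c).

(** All sides are expressed in the frame of one of them, so that every later
    computation is an identity between two coefficients. *)
Lemma side_shift i m :
  e (i + m)%N = cos (m%:R * turn) *: e i + sin (m%:R * turn) *: perp (e i).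
Proof.
elim: m => [|m IH].
  by rewrite addn0 mul0r cos0 sin0; coords; apply: pair_eq => /=; ring.
case: Preg => _ _ hs; rewrite addnS hs IH.
have -> : m.+1%:R * turn = m%:R * turn + turn by rewrite -natr1; ring.
rewrite cosD sinD.
by coords; apply: pair_eq => /=; ring.
Qed.

Lemma dot_side i : dot (e i) (e i) = 1.
Proof.
case: Preg => _ h1 _; have := h1 i; rewrite /enorm => h.
rewrite -[LHS]sqr_sqrtr ?h ?expr1n //.
by rewrite /dot -!expr2 addr_ge0 ?sqr_ge0.
Qed.

(** Agrees with [zeta c (i%:R + t)] for [0 <= t < 1], but makes sense for any
    vertex index and also at the far end [t = 1]. *)
Definition on_side (i : nat) (t : R) : R * R := c i + t *: e i.

(** The center of the polygon, reached from side [i] through its midpoint; the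
    apothem is half of [width]. *)
Definition center (i : nat) : R * R :=
  c i + 2^-1 *: e i + (width / 2) *: perp (e i).

Lemma center_shift i m : center (i + m) = center i.
Proof.
elim: m => [|m IH]; first by rewrite addn0.
rewrite addnS -IH; move: (i + m)%N => j.
have ec : c j.+1 = c j + e j by rewrite /side; apply: pair_eq => /=; ring.
have := side_shift j 1; rewrite addn1 mul1r => es.
rewrite /center ec es turn2 sinD cosD.
have S0 : sin half != 0 by rewrite gt_eqF // sin_half_gt0.
have hC := cos_half_sq; have hCS := cos_half_cube.
move: (e j) (c j) => [x y] [z w].
by coords; apply: pair_eq => /=; field: hC hCS.
Qed.

Lemma vertex_center i m :
  c (i + m) = center i - 2^-1 *: e (i + m)%N - (width / 2) *: perp (e (i + m)%N).
Proof.
by rewrite -(center_shift i m) /center; coords; apply: pair_eq => /=; ring.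
Qed.

Lemma on_side_shift i m t : on_side (i + m) t = center i
    + ((t - 2^-1) * cos (m%:R * turn) + width / 2 * sin (m%:R * turn)) *: e i
    + ((t - 2^-1) * sin (m%:R * turn) - width / 2 * cos (m%:R * turn)) *: perp (e i).
Proof.
by rewrite /on_side vertex_center side_shift; coords; apply: pair_eq => /=; ring.
Qed.

(** The signed distance of [p] to the line of side [i], positive on the inner
    side. *)
Definition gap (i : nat) (p : R * R) : R := cross (e i) (p - c i).

Lemma gap_ray i p r v : gap i (p + r *: v) = gap i p + r * cross (e i) v.
Proof. by rewrite /gap; coords; ring. Qed.

(** The gap is affine along the side; in this form its sign is visible, as for
    [0 < m < d] all the arguments of [sin] lie between 0 and [pi]. *)
Lemma gap_on_side_shift i m t : gap (i + m) (on_side i t) =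
  sin (m%:R * half) / sin half *
    (t * sin (m%:R * half - half) + (1 - t) * sin (m%:R * half + half)).
Proof.
have S0 : sin half != 0 by rewrite gt_eqF // sin_half_gt0.
rewrite /gap vertex_center side_shift /on_side /center turn2 mulrDr sinB.
rewrite !(sinD, cosD).
have := cos2Dsin2 (m%:R * half); have := dot_side i.
move: (e i) (c i) => [x y] [z w]; coords => he.
move: (sin (_ * _)) (cos (_ * _)) (sin half) (cos half) S0 => s k S C S0.
move=> /(canRL (addrK _)) => h2.
have {}he : x * x = 1 - y * y by rewrite -he addrK.
have hk : k * k = 1 - s ^+ 2 by rewrite -expr2.
by field: he hk.
Qed.

Lemma vertex_mod i : c (i %% d) = c i.
Proof.
have h k j : c (j + k * d)%N = c j.
  elim: k => [|k IH]; first by rewrite mul0n addn0.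
  by case: Preg => hp _ _; rewrite mulSn (addnC d) addnA hp.
by rewrite [in RHS](divn_eq i d) addnC h.
Qed.

Lemma side_mod i : e (i %% d) = e i.
Proof.
have h : c (i %% d).+1 = c i.+1.
  by rewrite -[LHS]vertex_mod -[RHS]vertex_mod -[in LHS]addn1 modnDml addn1.
by rewrite /side h vertex_mod.
Qed.

(** Reduces a statement about two sides to the number [m < d] of steps between
    them. *)
Lemma mod_shift i j : exists m,
  [/\ (m < d)%N, (j + m) %% d = i %% d & m = 0 -> i %% d = j %% d]%N.
Proof.
have d0 : (0 < d)%N by lia.
exists ((i + (d - j %% d)) %% d)%N; have hj : (j %% d < d)%N by rewrite ltn_mod.
have hE : ((j + (i + (d - j %% d)) %% d) %% d = i %% d)%N.
  rewrite modnDmr -modnDml.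
  have -> : (j %% d + (i + (d - j %% d)) = i + d)%N by lia.
  by rewrite modnDr.
by split; [rewrite ltn_mod | | move=> h; rewrite -hE h addn0].
Qed.

Lemma sin_mult_ge0 m : (m <= d)%N -> 0 <= sin (m%:R * half).
Proof.
move=> hm; apply: sin_ge0_pi; rewrite mulr_ge0 ?(ltW half_turn_gt0) //=.
by rewrite mulrCA ler_piMr ?pi_ge0 // ler_pdivrMr // mul1r ler_nat.
Qed.

Lemma sin_mult_gt0 m : (0 < m < d)%N -> 0 < sin (m%:R * half).
Proof.
case/andP=> m0 hm; apply: sin_gt0_pi; rewrite mulr_gt0 ?half_turn_gt0 ?ltr0n //=.
by rewrite mulrCA gtr_pMr ?pi_gt0 // ltr_pdivrMr // mul1r ltr_nat.
Qed.

Lemma gap_mod i p : gap (i %% d) p = gap i p.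
Proof. by rewrite /gap side_mod vertex_mod. Qed.

Lemma gap_on_side_ge0 i j t : 0 <= t <= 1 -> 0 <= gap i (on_side j t).
Proof.
move=> /andP[t0 t1]; have [m [md hE _]] := mod_shift i j.
rewrite -gap_mod -hE gap_mod gap_on_side_shift.
case: m md {hE} => [|m] md; first by rewrite mul0r sin0 !mul0r.
apply: mulr_ge0.
  by rewrite divr_ge0 ?(ltW sin_half_gt0) ?sin_mult_ge0 ?(ltnW md).
have -> : m.+1%:R * half - half = m%:R * half by rewrite -(natr1 m); ring.
have -> : m.+1%:R * half + half = m.+2%:R * half by rewrite -(natr1 m.+1); ring.
by apply: addr_ge0; apply: mulr_ge0; rewrite ?subr_ge0 //; apply: sin_mult_ge0; lia.
Qed.

Lemma gap_on_side_gt0 i j t :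
  0 < t < 1 -> (i %% d != j %% d)%N -> 0 < gap i (on_side j t).
Proof.
move=> /andP[t0 t1] hij; have [m [md hE h0]] := mod_shift i j.
rewrite -gap_mod -hE gap_mod gap_on_side_shift.
case: m md {hE} h0 => [|m] md h0; first by rewrite h0 ?eqxx in hij.
apply: mulr_gt0; first by rewrite divr_gt0 ?sin_half_gt0 ?sin_mult_gt0.
have -> : m.+1%:R * half - half = m%:R * half by rewrite -(natr1 m); ring.
have -> : m.+1%:R * half + half = m.+2%:R * half by rewrite -(natr1 m.+1); ring.
have [->|m0] := posnP m.
  rewrite mul0r sin0 mulr0 add0r mulr_gt0 ?subr_gt0 ?sin_mult_gt0 //.
  by lia.
apply: ltr_wpDr; first by rewrite mulr_ge0 ?subr_ge0 ?(ltW t1) ?sin_mult_ge0.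
by rewrite mulr_gt0 // sin_mult_gt0 // m0 ltnW.
Qed.

Lemma gap_on_own_side i t : gap i (on_side i t) = 0.
Proof. by have := gap_on_side_shift i 0 t; rewrite addn0 mul0r sin0 !mul0r. Qed.

(** On the line of side [j], the two neighbouring half-planes cut out exactly
    the side: the distance to them is [t], resp. [1 - t], times a positive
    factor. *)
Lemma face_on_side j p : (forall i, 0 <= gap i p) -> gap j p = 0 ->
  exists2 t, 0 <= t <= 1 & p = on_side j t.
Proof.
move=> hp hj; set t := dot (p - c j) (e j).
have pE : p = on_side j t.
  move: hj (dot_side j); rewrite /t /on_side /gap; case: (p) => px py.
  move: (e j) (c j) => [x y] [z w]; coords => h1 h2.
  have {}h2 : x * x = 1 - y * y by rewrite -h2 addrK.
  have h3 : x * py = x * w + y * (px - z) by rewrite -[RHS]addr0 -h1; ring.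
  have h4 : y * px = y * z + x * (py - w) by rewrite -[LHS]addr0 -h1; ring.
  by apply: pair_eq => /=; [ring: h3 h2 | ring: h4 h2].
exists t => //; have s2 : 0 < sin (half + half).
  have := @sin_mult_gt0 2; rewrite -[2]/(1+1) mulrDl mul1r; apply; lia.
apply/andP; split.
  (* The previous side, reached by [d.-1] steps forward. *)
  have := hp (j + d.-1)%N; rewrite pE gap_on_side_shift.
  have -> : d.-1%:R * half = pi - half.
    have hd : d%:R = d.-1%:R + 1 :> R by rewrite natr1 prednK //; lia.
    have -> : d.-1%:R = d%:R - 1 :> R by rewrite hd addrK.
    by field; rewrite lt0r_neq0.
  have -> : pi - half - half = pi - (half + half) by ring.
  rewrite subrK !sinB sinpi cospi !(mul0r, mulr0) sub0r mulN1r opprK.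
  rewrite divff ?(lt0r_neq0 sin_half_gt0) // mul1r addr0 sub0r mulN1r opprK.
  by rewrite pmulr_lge0.
have := hp (j + 1)%N; rewrite pE gap_on_side_shift mul1r subrr sin0 mulr0 add0r.
by rewrite divff ?(lt0r_neq0 sin_half_gt0) // mul1r pmulr_lge0 // subr_ge0.
Qed.


(** * The region bounded by the polygon *)

Lemma truncn_side i (t : R) : 0 <= t < 1 -> Num.truncn (i%:R + t) = i.
Proof.
by move=> /andP[t0 t1]; apply: truncn_def; rewrite lerDl t0 -natr1 ltrD2l.
Qed.

Lemma zeta_on_side i t : 0 <= t < 1 -> zeta c (i%:R + t) = on_side i t.
Proof. by move=> t01; rewrite /zeta truncn_side // addrAC subrr add0r. Qed.

Lemma on_side_mod i t : on_side (i %% d) t = on_side i t.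
Proof. by rewrite /on_side side_mod vertex_mod. Qed.

Lemma on_side0 i : on_side i 0 = c i.
Proof. by rewrite /on_side scale0r addr0. Qed.

Lemma on_side1 i : on_side i 1 = c i.+1.
Proof. by rewrite /on_side scale1r /side addrC subrK. Qed.

Lemma bdry_on_side i t : 0 <= t <= 1 -> bdry d c (on_side i t).
Proof.
move=> /andP[t0]; have id' : (i %% d < d)%N by rewrite ltn_mod; lia.
rewrite -on_side_mod le_eqVlt => /orP[/eqP->|t1].
  exists (i %% d).+1%:R; first by rewrite /= in_itv /= ler0n ler_nat.
  by rewrite -[_.+1%:R]addr0 zeta_on_side ?lexx ?ltr01 // on_side0 on_side1.
exists ((i %% d)%:R + t); last by rewrite zeta_on_side ?t0.
rewrite /= in_itv /= addr_ge0 //=.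
by rewrite (@le_trans _ _ (i %% d).+1%:R) ?ler_nat // -natr1 lerD2l ltW.
Qed.

Lemma bdryP p : bdry d c p -> exists i t, 0 <= t <= 1 /\ p = on_side i t.
Proof.
move=> [s]; rewrite /= in_itv /= => /andP[s0 sd] <-.
exists (Num.truncn s), (s - (Num.truncn s)%:R); split=> //.
have /andP[h1] := truncn_itv s0; rewrite -natr1 => h2.
by rewrite subr_ge0 h1 lerBlDl ltW.
Qed.

Lemma continuous_gap i : continuous (gap i).
Proof.
move=> p; rewrite /gap /cross.
apply: cvgB; apply: cvgM; try exact: cvg_cst.
  by apply: cvgB; [exact: cvg_snd|exact: cvg_cst].
by apply: cvgB; [exact: cvg_fst|exact: cvg_cst].
Qed.

Definition polygon : set (R * R) := [set p | forall i, 0 <= gap i p].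

Lemma bdry_polygon p : bdry d c p -> polygon p.
Proof. by move=> /bdryP[i [t [t01 ->]]] j; apply: gap_on_side_ge0. Qed.

Lemma polygon_closed : closed polygon.
Proof.
have -> : polygon = \bigcap_(i in setT) (gap i @^-1` [set x | 0 <= x]).
  by apply/seteqP; split=> p hp i; [move=> _|]; exact: hp.
apply: closed_bigI => i _; apply: closed_comp; last exact: closed_ge.
by move=> p _; exact: continuous_gap.
Qed.

Lemma gap_center i p : gap i p = width / 2 + cross (e i) (p - center i).
Proof.
rewrite /gap /center; have := dot_side i; move: (e i) (c i) => [x y] [z w].
by coords => h; rewrite -[X in _ = X + _]mulr1 -h; ring.
Qed.

Context (d_even : ~~ odd d).

Lemma half_turns : (d./2)%:R * turn = pi.
Proof.
have -> : turn = pi / (d./2)%:R.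
  rewrite -{1}(even_halfK d_even) -mul2n natrM; field.
  by rewrite !pnatr_eq0; lia.
by rewrite mulrC divfK // pnatr_eq0; lia.
Qed.

Lemma side_opp i : e (i + d./2)%N = - e i.
Proof.
by rewrite side_shift half_turns cospi sinpi scaleN1r scale0r addr0.
Qed.

(** Each side has an opposite one, so a point of the polygon lies in the strip
    between the two lines. *)
Lemma polygon_cross i p : polygon p -> `|cross (e i) (p - center 0)| <= width / 2.
Proof.
have hc j : center j = center 0 by rewrite -(center_shift 0 j).
move=> hp; have := hp i; have := hp (i + d./2)%N; rewrite !gap_center side_opp !hc.
move: (p - _) => w.
by rewrite ler_norml /cross /=; lra.
Qed.

(** The strips of two consecutive, hence not parallel, sides have a bounded
    intersection. *)
Lemma polygon_bounded : bounded_set polygon.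
Proof.
have st : 0 < sin turn.
  by have := @sin_mult_gt0 2; rewrite turn2 -[2]/(1+1) mulrDl mul1r; apply; lia.
pose B := width / sin turn + width.
exists (`|center 0| + 2 * B); split; first exact: num_real.
move=> M /ltW hM p hp; apply: le_trans hM.
rewrite -[p](subrK (center 0)) addrC; apply: le_trans (ler_normD _ _) _.
rewrite lerD2l.
have h0 := polygon_cross 0 hp; have := polygon_cross 1 hp.
have -> : e 1 = cos turn *: e 0 + sin turn *: perp (e 0).
  by have := side_shift 0 1; rewrite add0n mul1r.
have he := dot_side 0.
move: (p - center 0) h0 => w h0.
have -> : cross (cos turn *: e 0 + sin turn *: perp (e 0)) w =
    cos turn * cross (e 0) w - sin turn * dot (e 0) w by coords; ring.
move=> h1.
have hw : 0 < width by rewrite divr_gt0 ?sin_half_gt0 ?cos_half_gt0.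
have hdot : `|dot (e 0) w| <= width / sin turn.
  rewrite ler_pdivlMr // -(gtr0_norm st) -normrM mulrC.
  have -> : sin turn * dot (e 0) w = cos turn * cross (e 0) w -
    (cos turn * cross (e 0) w - sin turn * dot (e 0) w) by ring.
  apply: le_trans (ler_normB _ _) _; rewrite normrM.
  have : `|cos turn| * `|cross (e 0) w| <= 1 * (width / 2).
    by rewrite ler_pM // cos_max.
  lra.
have [ha hb] : `|(e 0).1| <= 1 /\ `|(e 0).2| <= 1.
  move: he; rewrite /dot -!expr2 => he.
  by split; rewrite ler_norml; apply/andP; split; nra.
have hB : `|dot (e 0) w| + `|cross (e 0) w| <= B by rewrite /B; lra.
have B0 : 0 <= B by apply: le_trans hB; rewrite addr_ge0.
suff [h2 h3] : `|w.1| <= B /\ `|w.2| <= B.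
  by rewrite prod_normE ge_max; apply/andP; split; lra.
have -> : w.1 = (e 0).1 * dot (e 0) w - (e 0).2 * cross (e 0) w.
  by rewrite -[LHS]mulr1 -he; coords; ring.
have -> : w.2 = (e 0).2 * dot (e 0) w + (e 0).1 * cross (e 0) w.
  by rewrite -[LHS]mulr1 -he; coords; ring.
split.
  apply: le_trans (ler_normB _ _) (le_trans _ hB); rewrite !normrM.
  by apply: lerD; rewrite ler_piMl.
apply: le_trans (ler_normD _ _) (le_trans _ hB); rewrite !normrM.
by apply: lerD; rewrite ler_piMl.
Qed.

(** A point outside a half-plane can be moved to infinity away from it without
    meeting the boundary curve. For a point inside, the polygon and the union
    of the complementary closed half-planes are two closed sets which cover the
    plane and meet only along the boundary curve, so the component of the
    point stays in the polygon. *)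
Lemma region_polygon : region d c = polygon.
Proof.
apply/seteqP; split=> p.
  case=> [/bdry_polygon//|[pb [M [_ hM]]] i].
  rewrite leNgt; apply/negP => gi.
  pose ray (r : R) := p + r *: - perp (e i).
  have rayC : continuous ray.
    move=> r; apply: cvgD; first exact: cvg_cst.
    by apply: cvgZr_tmp; exact: cvg_id.
  have gapray r : gap i (ray r) = gap i p - r.
    rewrite gap_ray; congr (_ + _); rewrite -[RHS]mulr1 -(dot_side i).
    by coords; ring.
  have sub r : 0 <= r -> connected_component (~` bdry d c) p (ray r).
    move=> r0; apply: (@connected_component_max _ _ (ray @` `[0, r]) p).
    - by exists 0; rewrite /= ?in_itv /= ?lexx // /ray scale0r addr0.
    - move=> q [s]; rewrite /= in_itv /= => /andP[s0 _] <- /bdry_polygon/(_ i).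
      by rewrite gapray; lra.
    - apply: connected_continuous_connected; first exact: segment_connected.
      by apply: continuous_subspaceT; exact: rayC.
    - by exists r; rewrite //= in_itv /= r0 lexx.
  have v0 : 0 < `|perp (e i)|.
    rewrite normr_gt0; apply/eqP => h; have := dot_side i; move: h.
    move=> h; have h1 : - (e i).2 = 0 := congr1 fst h.
    have h2 : (e i).1 = 0 := congr1 snd h.
    by rewrite /dot h2 -[(e i).2]opprK h1; lra.
  pose r := (`|p| + `|M| + 2) / `|perp (e i)|.
  have r0 : 0 <= r by rewrite divr_ge0 ?addr_ge0.
  have /hM/(_ _ (sub _ r0)) /= : M < `|M| + 1 by rewrite ltr_pwDr // ler_norm.
  have := lerB_normD (r *: - perp (e i)) p.
  have -> : r *: - perp (e i) + p = ray r by rewrite addrC.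
  rewrite normrZ normrN (ger0_norm r0) divfK ?gt_eqF //; lra.
move=> hp; have [pb|pb] := pselect (bdry d c p); [by left|right; split=> //].
apply: sub_boundedr polygon_bounded.
set C := connected_component _ _.
pose E := \bigcup_(i in `I_d) (gap i @^-1` [set x | x <= 0]).
have cE : closed E.
  apply: closed_bigcup => // i _; apply: closed_comp; last exact: closed_le.
  by move=> q _; exact: continuous_gap.
have disj q : C q -> polygon q -> E q -> False.
  move=> Cq pq [i _ /= gi]; have := connected_component_sub Cq; apply.
  have [|t t01 ->] := @face_on_side i q pq; last exact: bdry_on_side.
  by apply/eqP; rewrite eq_le gi pq.
have [] := @connected_subset _ (C `&` polygon) (C `&` E) C.
- split; rewrite -subset0 => q [].
    by move=> /(closure_subset (@subIsetr _ C _)); rewrite -(closure_id _).1 //;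
       [move=> h [Cq]; exact: disj | exact: polygon_closed].
  move=> [Cq h] /(closure_subset (@subIsetr _ C _)).
  by rewrite -(closure_id _).1 //; exact: disj.
- move=> q Cq; have [h|h] := pselect (polygon q); [by left|right; split=> //].
  apply: contrapT => h2; apply: h => i; rewrite -gap_mod leNgt; apply/negP => h3.
  by apply: h2; exists (i %% d)%N; rewrite /= ?ltn_mod ?(ltW h3) //; lia.
- exact: component_connected.
- by move=> h A hA q /h[_ /hA].
move=> h; exfalso; apply: (disj p); [exact: connected_component_refl|exact: hp|].
by have [] := h p (connected_component_refl pb).
Qed.

Lemma derive_zeta i t : 0 < t < 1 -> derive1 (zeta c) (i%:R + t) = e i.
Proof.
move=> /andP[t0 t1]; rewrite derive1E /derive.
apply: cvg_lim => //; apply: cvg_near_cst.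
have hE : \forall h \near (0 : R), 0 < t + h < 1.
  exists (Num.min t (1 - t)); first by rewrite /= lt_min t0 subr_gt0.
  by move=> h /=; rewrite sub0r normrN lt_min !ltr_norml; lra.
near=> h.
have h0 : h != 0 by near: h; exact: nbhs_dnbhs_neq.
have h1 : 0 < t + h < 1 by near: h; exact: cvg_within.
set X := (X in zeta c X - _).
have {X}-> : X = i%:R + (t + h) by rewrite /X /GRing.scale /=; ring.
rewrite !zeta_on_side ?(ltW t0) ?t1 //; last by case/andP: h1 => /ltW -> ->.
rewrite /on_side; coords; apply: pair_eq => /=; by field.
Unshelve. all: by end_near.
Qed.

(** * Flights *)

Lemma positionE i t th : 0 <= t < 1 -> position c (i%:R + t, th) = on_side i t.
Proof. exact: zeta_on_side. Qed.

Lemma velocityE i t th : 0 < t < 1 ->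
  velocity c (i%:R + t, th) = sin th *: e i + cos th *: perp (e i).
Proof.
move=> t01; rewrite /velocity /= derive_zeta //.
have -> : pi / 2 - th = - (th - pi / 2) by ring.
rewrite /Defs.rot cosN sinN cosBpihalf sinBpihalf.
by rewrite !pair_scaleE; apply: pair_eq; rewrite /perp [in LHS]/= [in RHS]/=; ring.
Qed.

(** By convexity the flight stays in the polygon up to [tau]; past [tau] it is
    on the wrong side of the line [j], which it crosses outwards. *)
Lemma flight_timeE x j tau : polygon (position c x) ->
  polygon (position c x + tau *: velocity c x) -> 0 < tau ->
  gap j (position c x + tau *: velocity c x) = 0 ->
  cross (e j) (velocity c x) < 0 -> flight_time d c x = tau.
Proof.
rewrite /flight_time region_polygon.
move: (position c x) (velocity c x) => p v hp hq tau0 hj hv.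
rewrite -[RHS](@sup_itv R (BRight 0) false tau); last by rewrite bnd_simp.
congr sup; apply/seteqP; split=> r /=; rewrite in_itv /=.
  move=> [r0 hr]; rewrite r0 /= leNgt; apply/negP => tr.
  have /(_ j) : polygon (p + ((tau + r) / 2) *: v) by apply: hr; lra.
  move: hj; rewrite !gap_ray => hj; nra.
move=> /andP[r0 rtau]; split=> // s /andP[s0 sr] k.
have := hq k; have := hp k; rewrite !gap_ray => h1 h2; nra.
Qed.

Lemma on_side_polygon j t : 0 <= t <= 1 -> polygon (on_side j t).
Proof. by move=> t01 i; apply: gap_on_side_ge0. Qed.

Lemma hitE x j t tau : polygon (position c x) -> 0 < tau -> 0 <= t <= 1 ->
  position c x + tau *: velocity c x = on_side j t ->
  cross (e j) (velocity c x) < 0 -> hit d c x = on_side j t.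
Proof.
move=> hp tau0 t01 hq hv; rewrite /hit -hq (@flight_timeE x j tau) ?hq //.
  exact: on_side_polygon.
exact: gap_on_own_side.
Qed.

Lemma on_side_inj j t t' : on_side j t = on_side j t' -> t = t'.
Proof.
move=> h; rewrite -[t]mulr1 -[t']mulr1 -(dot_side j).
have h1 : (c j).1 + t * (e j).1 = (c j).1 + t' * (e j).1 := congr1 fst h.
have h2 : (c j).2 + t * (e j).2 = (c j).2 + t' * (e j).2 := congr1 snd h.
have {}h1 := addrI _ h1; have {}h2 := addrI _ h2.
by rewrite /dot !mulrDr !mulrA h1 h2.
Qed.

(** A point inside a side is at positive distance from all other sides, so it
    has only one parameter. *)
Lemma hit_paramE x j t : (j < d)%N -> 0 < t < 1 -> hit d c x = on_side j t ->
  hit_param d c x = j%:R + t.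
Proof.
move=> jd /andP[t0 t1] hx.
apply: xget_unique => /=.
  rewrite zeta_on_side ?(ltW t0) // hx addr_ge0 ?(ltW t0) //=; split=> //.
  by rewrite (@le_trans _ _ j.+1%:R) ?ler_nat // -natr1 lerD2l ltW.
move=> s [/andP[s0 sd]]; rewrite hx => hs.
have /andP[h1 h2] := truncn_itv s0; rewrite -natr1 in h2.
set k := Num.truncn s in h1 h2.
have sE : s = k%:R + (s - k%:R) by ring.
have sk : 0 <= s - k%:R < 1 by lra.
rewrite sE zeta_on_side // in hs.
have hk : (k %% d = j %% d)%N.
  apply/eqP; apply: contraT => kj.
  have := gap_on_side_gt0 _ kj; move=> /(_ t).
  by rewrite -hs gap_on_own_side t0 t1 ltxx => /(_ isT).
have skt : s - k%:R = t.
  by apply: (@on_side_inj j); rewrite -hs -on_side_mod -hk on_side_mod.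
rewrite sE skt; congr (_%:R + _).
rewrite -(modn_small jd) -hk modn_small // -(ltr_nat R); lra.
Qed.

Lemma hit_angleE x j t : (j < d)%N -> 0 < t < 1 -> hit d c x = on_side j t ->
  hit_angle d c x = asin (dot (e j) (velocity c x)).
Proof.
move=> jd t01 hx; rewrite /hit_angle /reflected (hit_paramE jd t01 hx).
rewrite derive_zeta //; congr asin; have := dot_side j.
move: (e j) (velocity c x) => [x1 y1] [z w]; coords => h.
by have {}h : x1 * x1 = 1 - y1 * y1; [rewrite -h addrK | ring: h].
Qed.

(** The flight ends when it first meets the line of a side which it approaches,
    the side opposite to the initial one being approached. *)
Lemma exit_exists i t th : 0 < t < 1 -> angles th ->
  exists j t' tau, [/\ (j < d)%N, 0 < tau, 0 <= t' <= 1,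
    on_side i t + tau *: velocity c (i%:R + t, th) = on_side j t'
    & cross (e j) (velocity c (i%:R + t, th)) < 0].
Proof.
move=> t01 hth; rewrite velocityE //; set v := _ + _.
have cth : 0 < cos th.
  by apply: cos_gt0_pihalf; move: hth; rewrite /angles /= in_itv.
have ci : cross (e i) v = cos th.
  by rewrite /v -[RHS]mulr1 -(dot_side i); coords; ring.
have d0 : (0 < d)%N by lia.
pose j0 := Ordinal (ltn_pmod (i + d./2) d0).
have hj0 : cross (e j0) v < 0.
  rewrite side_mod side_opp.
  have -> : cross (- e i) v = - cross (e i) v by coords; ring.
  by rewrite ci oppr_lt0.
pose F (j : 'I_d) := gap j (on_side i t) / - cross (e j) v.
have := @arg_minP _ _ _ j0 (fun j : 'I_d => cross (e j) v < 0) F hj0.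
move=> [j /= hj hmin].
have hp : polygon (on_side i t) by apply: on_side_polygon; lra.
have hF : 0 < F j.
  rewrite divr_gt0 ?oppr_gt0 // gap_on_side_gt0 //; apply: contraTneq hj.
  by rewrite -side_mod => ->; rewrite side_mod ci -leNgt ltW.
have hq : polygon (on_side i t + F j *: v).
  move=> k; rewrite -gap_mod gap_ray.
  have [hk|hk] := leP 0 (cross (e (k %% d)) v).
    by rewrite addr_ge0 // mulr_ge0 // ltW.
  have := hmin (Ordinal (ltn_pmod k d0)) hk; rewrite [F (Ordinal _)]/F /=.
  by rewrite ler_pdivlMr ?oppr_gt0 // gap_mod; lra.
have hFj : gap j (on_side i t + F j *: v) = 0.
  by rewrite gap_ray /F; field; rewrite lt_eqF.
have [t' t'01 hE] := face_on_side hq hFj.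
by exists j, t', (F j).
Qed.

(** * The billiard map on regular points *)

Lemma phase_sideP (x : R * R) : (phase d `\` vertex_lines d) x ->
  exists i t, [/\ (i < d)%N, 0 < t < 1, angles x.2 & x = (i%:R + t, x.2)].
Proof.
case: x => s th [[/= + hth] hv]; rewrite in_itv /= => /andP[s0 sd].
have /andP[h1 h2] := truncn_itv (ltW s0); rewrite -natr1 in h2.
move: (Num.truncn s) h1 h2 => i h1 h2.
have id' : (i < d)%N by rewrite -(ltr_nat R); lra.
have si : s != i%:R.
  by apply: contra_not_neq hv => ->; split=> //=; exists i => //=; exact: ltnW.
exists i, (s - i%:R); split=> //; last by rewrite addrC subrK.
by rewrite subr_gt0 lt_neqAle eq_sym si h1 /=; lra.
Qed.

Lemma side_phase i (t th : R) : (i < d)%N -> 0 < t < 1 -> angles th ->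
  (phase d `\` vertex_lines d) (i%:R + t, th).
Proof.
move=> id' /andP[t0 t1] hth; split.
  split=> //=; rewrite in_itv /= ltr_wpDl //=.
  by rewrite (@lt_le_trans _ _ i.+1%:R) ?ler_nat // -natr1 ltrD2l.
move=> [[k /= _ hk] _]; have := @truncn_side i t; rewrite -hk natrK => h.
by move: hk; rewrite h ?(ltW t0) //; lra.
Qed.

Lemma billiard_domP x : billiard_dom d c x ->
  (phase d `\` vertex_lines d) x /\ forall k, hit d c x <> c k.
Proof.
move=> [hx hs]; have hp : (phase d `\` vertex_lines d) x.
  by split=> // hv; apply: hs; left; right.
split=> // k hk; apply: hs; right; exists (k %% d)%N.
  by rewrite ltn_mod (leq_trans _ d_ge6).
by apply: subset_closure; split=> //; rewrite vertex_mod.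
Qed.

Lemma velocity_unit i t th : 0 < t < 1 ->
  dot (velocity c (i%:R + t, th)) (velocity c (i%:R + t, th)) = 1.
Proof.
move=> t01; rewrite velocityE // -(cos2Dsin2 th) -[RHS]mulr1 -(dot_side i).
by coords; ring.
Qed.

Section Step.
Variable f : R -> R.

(** The end of the flight is not a vertex, as the closure that defines
    [corner_set] contains the set itself. *)
Lemma billiard_step x : billiard_dom d c x -> exists j t,
  [/\ (j < d)%N, 0 < t < 1, cross (e j) (velocity c x) < 0 &
      billiard_map d c f x = (j%:R + t, f (asin (dot (e j) (velocity c x))))].
Proof.
move=> /billiard_domP[/phase_sideP[i [t [id' t01 hth xE]]] hcorner].
have [j [t' [tau [jd tau0 t'01 hE hj]]]] := exit_exists i t01 hth.
rewrite -xE in hE hj.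
have hit_E : hit d c x = on_side j t'.
  apply: (@hitE x j t' tau) => //;
    rewrite [in position _ _]xE positionE //; try lra.
  by apply: on_side_polygon; lra.
have {t'01} t'01 : 0 < t' < 1.
  case/andP: t'01 => h0 h1; rewrite !lt_neqAle h0 h1 !andbT.
  apply/andP; split; apply/eqP => h.
    by apply: (hcorner j); rewrite hit_E -h on_side0.
  by apply: (hcorner j.+1); rewrite hit_E h on_side1.
exists j, t'; split; [exact: jd|exact: t'01|exact: hj|].
by rewrite /billiard_map (hit_paramE jd t'01 hit_E) (hit_angleE jd t'01 hit_E).
Qed.

(** The flight is transversal to the side that it hits, so it does not leave
    along the side. *)
Lemma asin_angles (u v : R * R) : dot u u = 1 -> dot v v = 1 -> cross u v != 0 ->
  angles (asin (dot u v)) .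
Proof.
move=> hu hv hc; have : (dot u v) ^+ 2 < 1.
  have -> : 1 = (dot u v) ^+ 2 + (cross u v) ^+ 2.
    by rewrite -[LHS]mulr1 -{1}hu -hv; coords; ring.
  by rewrite ltrDl lt_neqAle sqr_ge0 andbT eq_sym sqrf_eq0.
move=> h; rewrite /angles /= in_itv /=.
by rewrite asin_gtNpi2 ?asin_ltpi2 //; apply/andP; split; nra.
Qed.

Lemma regular_dom x : regular_points d c f x -> billiard_dom d c x.
Proof. by move=> [hx hs]; split=> // h; apply: hs; exists 0%N. Qed.

Context (f_angles : forall t, @angles R t -> angles (f t)).

Lemma billiard_map_phase x : billiard_dom d c x ->
  (phase d `\` vertex_lines d) (billiard_map d c f x).
Proof.
move=> hx; have [/phase_sideP[i [s [id' s01 hth xE]]] _] := billiard_domP hx.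
have [j [t [jd t01 hj ->]]] := billiard_step hx.
apply: side_phase => //; apply: f_angles; apply: asin_angles.
- exact: dot_side.
- by rewrite xE velocity_unit.
- by rewrite lt_eqF.
Qed.

Lemma regular_step x : regular_points d c f x ->
  regular_points d c f (billiard_map d c f x).
Proof.
move=> hx; have hd := regular_dom hx; split.
  by have [] := billiard_map_phase hd.
by move=> [k _ hk]; case: hx => _; apply; exists k.+1 => //; right.
Qed.

(** To find the end of a flight it is enough to exhibit it: the two equations
    are the coordinates, in the frame of side [i] with origin at the center,
    of the equality between the end of the flight and the point [t'] of side
    [i + m]. *)
Lemma targeted_hit i m t t' th tau :
  0 < t < 1 -> 0 <= t' <= 1 -> 0 < tau ->
  (t - 2^-1) + tau * sin th
    = (t' - 2^-1) * cos (m%:R * turn) + width / 2 * sin (m%:R * turn) ->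
  - (width / 2) + tau * cos th
    = (t' - 2^-1) * sin (m%:R * turn) - width / 2 * cos (m%:R * turn) ->
  cos (m%:R * turn + th) < 0 ->
  hit d c (i%:R + t, th) = on_side (i + m) t'.
Proof.
move=> t01 t'01 tau0 h1 h2 hc; apply: (@hitE _ (i + m)%N t' tau) => //.
- by rewrite positionE; [apply: on_side_polygon|]; lra.
- rewrite positionE; last lra.
  rewrite velocityE // on_side_shift -h1 -h2.
  have := on_side_shift i 0 t; rewrite addn0 => ->.
  by rewrite mul0r cos0 sin0; coords; apply: pair_eq => /=; ring.
- rewrite velocityE // side_shift.
  have -> : cross (cos (m%:R * turn) *: e i + sin (m%:R * turn) *: perp (e i))
     (sin th *: e i + cos th *: perp (e i)) = cos (m%:R * turn + th) * dot (e i) (e i).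
    by rewrite cosD; coords; ring.
  by rewrite dot_side mulr1.
Qed.

Lemma targeted_step i m t t' th :
  0 < t < 1 -> 0 < t' < 1 ->
  hit d c (i%:R + t, th) = on_side (i + m) t' ->
  billiard_map d c f (i%:R + t, th)
    = (((i + m) %% d)%N%:R + t', f (asin (sin (m%:R * turn + th)))).
Proof.
move=> t01 t'01; rewrite -on_side_mod => hE.
have hm : ((i + m) %% d < d)%N by rewrite ltn_mod (leq_trans _ d_ge6).
rewrite /billiard_map (hit_paramE hm t'01 hE) (hit_angleE hm t'01 hE).
rewrite velocityE // side_mod side_shift.
have -> : dot (cos (m%:R * turn) *: e i + sin (m%:R * turn) *: perp (e i))
     (sin th *: e i + cos th *: perp (e i)) = sin (m%:R * turn + th) * dot (e i) (e i).
  by rewrite sinD; coords; ring.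
by rewrite dot_side mulr1.
Qed.


(** Coordinates in which the two directions of drift look the same: the sign [s]
    says to which end of side [i] the flight drifts, [w] is the distance to
    that end, and [phi] is the size of the angle. *)
Definition collision (i : nat) (s w phi : R) : R * R :=
  (i%:R + (2^-1 + s * (2^-1 - w)), s * phi).

Context (f_odd : forall t, @angles R t -> f (- t) = - f t).

Lemma collision_param s (w : R) : s = 1 \/ s = - 1 -> 0 < w < 1 ->
  0 < 2^-1 + s * (2^-1 - w) < 1.
Proof. by case=> -> /andP[w0 w1]; apply/andP; split; lra. Qed.

Lemma asin_sin_sign s (phi : R) : s = 1 \/ s = - 1 -> 0 <= phi < pi / 2 ->
  asin (s * sin phi) = s * phi.
Proof.
move=> hs /andP[h0 h1]; have -> : s * sin phi = sin (s * phi).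
  by case: hs => ->; rewrite ?mul1r // !mulN1r sinN.
by rewrite sinK // in_itv /=; case: hs => ->; apply/andP; split; lra.
Qed.

Lemma f_sign s phi : s = 1 \/ s = - 1 -> 0 <= phi < pi / 2 ->
  f (s * phi) = s * f phi.
Proof.
case=> -> /andP[h0 h1]; rewrite ?mul1r // !mulN1r f_odd //.
by rewrite /angles /= in_itv /=; lra.
Qed.

Lemma parallel_hit i s w phi : s = 1 \/ s = - 1 -> 0 < w < 1 ->
  0 <= phi < pi / 2 -> 0 <= w - width * tan phi ->
  hit d c (collision i s w phi)
    = on_side (i + d./2) (2^-1 - s * (2^-1 - (w - width * tan phi))).
Proof.
move=> hs w01 phi0 hw; have cphi : 0 < cos phi by apply: cos_gt0_pihalf; lra.
have W0 : 0 < width by rewrite divr_gt0 ?sin_half_gt0 ?cos_half_gt0.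
have tphi : 0 <= tan phi.
  by rewrite /tan divr_ge0 ?(ltW cphi) // sin_ge0_pi //; have := pi_gt0 R; lra.
have hwt : 0 <= width * tan phi by rewrite mulr_ge0 // ltW.
apply: (@targeted_hit i d./2 _ _ _ (width / cos phi)).
- exact: collision_param.
- by case: hs => ->; apply/andP; split; lra.
- by rewrite divr_gt0.
- rewrite half_turns cospi sinpi /tan; have cphi0 : cos phi != 0 by rewrite gt_eqF.
  have S0 : sin half != 0 by rewrite gt_eqF // sin_half_gt0.
  by case: hs => ->; rewrite ?mul1r ?mulN1r ?sinN; field; apply/andP.
- rewrite half_turns cospi sinpi; have -> : cos (s * phi) = cos phi.
    by case: hs => ->; rewrite ?mul1r ?mulN1r ?cosN.
  by rewrite divfK ?gt_eqF //; field; rewrite gt_eqF // sin_half_gt0.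
- rewrite half_turns addrC cosDpi oppr_lt0.
  by case: hs => ->; rewrite ?mul1r ?mulN1r ?cosN.
Qed.

(** A flight to the parallel side uses up [width * tan phi] of the room [w]. The
    sign changes because opposite sides are run in opposite directions: the
    drift itself keeps its direction. *)
Lemma parallel_step i s w phi : s = 1 \/ s = - 1 -> 0 < w < 1 ->
  0 <= phi < pi / 2 -> 0 < w - width * tan phi ->
  billiard_map d c f (collision i s w phi)
    = collision ((i + d./2) %% d) (- s) (w - width * tan phi) (f phi).
Proof.
move=> hs w01 phi0 hw; have cphi : 0 < cos phi by apply: cos_gt0_pihalf; lra.
have W0 : 0 < width by rewrite divr_gt0 ?sin_half_gt0 ?cos_half_gt0.
have tphi : 0 <= tan phi.
  by rewrite /tan divr_ge0 ?(ltW cphi) // sin_ge0_pi //; have := pi_gt0 R; lra.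
have hwt : 0 <= width * tan phi by rewrite mulr_ge0 // ltW.
rewrite (targeted_step _ _ (parallel_hit i hs w01 phi0 (ltW hw))); first last.
- by case: hs => ->; apply/andP; split; lra.
- exact: collision_param.
rewrite half_turns (addrC pi) sinDpi.
have -> : - sin (s * phi) = (- s) * sin phi.
  by case: hs => ->; rewrite ?mul1r ?mulN1r ?opprK ?mul1r ?sinN ?opprK.
have hs' : - s = 1 \/ - s = - 1.
  by case: hs => ->; [right|left; rewrite opprK].
rewrite asin_sin_sign // f_sign // /collision.
by congr (_ + (_ + _), _); ring.
Qed.

(** When the drift is too large, the side hit is the neighbour of the parallel
    side on the side of the drift. *)
Lemma exit_turn s : s = 1 \/ s = - 1 -> exists m, m%:R * turn = pi - s * turn.
Proof.
have hd : (0 < d./2)%N by lia.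
have := half_turns; set T := 2 * pi / _ => <-.
case=> ->; [exists d./2.-1|exists d./2.+1].
  have -> : d./2%:R = d./2.-1%:R + 1 :> R by rewrite natr1 prednK.
  by ring.
by rewrite -(natr1 d./2); ring.
Qed.

(** The left-hand side is the room after an exit. For [phi = half] a flight from
    the very end of the side ([w = 0]) would reach the vertex at the other end
    of the side hit; for smaller angles it falls short of it. *)
Lemma exit_coord_lt1 w phi : 0 < w -> 0 <= phi < half ->
  (width * sin phi - w * cos phi) / cos (turn - phi) < 1.
Proof.
move=> w0 /andP[h0 h1]; have S0 := sin_half_gt0; have := turn_le; rewrite turn2 => t3.
have pi0 := pi_gt0 R.
have D0 : 0 < cos (half + half - phi) by apply: cos_gt0_pihalf; lra.
have c2 : 0 < cos (half + half) by apply: cos_gt0_pihalf; have := half_turn_gt0; lra.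
have cphi : 0 < cos phi by apply: cos_gt0_pihalf; lra.
rewrite ltr_pdivrMr // mul1r.
apply: (@lt_trans _ _ (width * sin phi)); first by rewrite gtrBl mulr_gt0.
rewrite -subr_gt0.
have -> : cos (half + half - phi) - width * sin phi =
   cos (half + half) * sin (half - phi) / sin half.
  rewrite cosB sinB cosD sinD.
  by field: cos_half_sq cos_half_cube; rewrite gt_eqF.
by rewrite divr_gt0 // mulr_gt0 // sin_gt0_pi //; lra.
Qed.

(** The room after an exit results from eliminating the time of flight [tau]
    from the equations of [targeted_hit]; the sign does not change: the orbit
    drifts towards the vertex between the side hit and the parallel side, and
    the new room is the distance to this vertex. *)
Lemma exit_step i s w phi : s = 1 \/ s = - 1 -> 0 < w < 1 ->
  0 <= phi < half -> w < width * tan phi ->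
  exists j, (j < d)%N /\ billiard_map d c f (collision i s w phi)
    = collision j s ((width * sin phi - w * cos phi) / cos (turn - phi)) (f (turn - phi)).
Proof.
move=> hs w01 hphi hw; have [m hm] := exit_turn hs.
have [w0 w1] := andP w01; have [p0 p1] := andP hphi.
have h1 := exit_coord_lt1 w0 hphi.
have S0 := sin_half_gt0; have C0 := cos_half_gt0; have t3 := turn_le.
have pi0 := pi_gt0 R; have h0 := half_turn_gt0.
have tE := turn2.
have D0 : 0 < cos (turn - phi) by apply: cos_gt0_pihalf; lra.
have c2 : 0 < cos turn by apply: cos_gt0_pihalf; lra.
have cphi : 0 < cos phi by apply: cos_gt0_pihalf; lra.
have W0 : 0 < width by rewrite divr_gt0.
set w' := _ / _ in h1 *.
have w'0 : 0 < w'.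
  by rewrite divr_gt0 // subr_gt0 -ltr_pdivlMr // -[X in _ < X]mulrA; exact: hw.
have w'D : w' * cos (turn - phi) = width * sin phi - w * cos phi.
  by rewrite divfK // gt_eqF.
have hcm : cos (m%:R * turn) = - cos turn.
  by rewrite hm cosB cospi sinpi; case: hs => ->; rewrite ?mul1r ?mulN1r ?cosN; ring.
have hsm : sin (m%:R * turn) = s * sin turn.
  by rewrite hm sinB cospi sinpi; case: hs => ->; rewrite ?mul1r ?mulN1r ?sinN; ring.
have hang : m%:R * turn + s * phi = pi - s * (turn - phi) by rewrite hm; ring.
(* The second equation of [targeted_hit], solved for the time of flight. *)
set tau := (width / 2 + (2^-1 - w') * sin turn + width / 2 * cos turn) / cos phi.
have tau0 : 0 < tau.
  rewrite divr_gt0 //.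
  have st : 0 < sin turn by apply: sin_gt0_pi; lra.
  have : (2^-1 - 1) * sin turn <= (2^-1 - w') * sin turn by rewrite ler_wpM2r ?ltW //; lra.
  have : width / 2 + (2^-1 - 1) * sin turn + width / 2 * cos turn = width * cos turn.
    rewrite tE sinD cosD.
    by field: cos_half_sq cos_half_cube; rewrite gt_eqF.
  have : 0 < width * cos turn by rewrite mulr_gt0.
  lra.
have hs2 : s * s = 1 by case: hs => ->; ring.
have hsn x : sin (s * x) = s * sin x.
  by case: hs => ->; rewrite ?mul1r ?mulN1r ?sinN.
have hcn x : cos (s * x) = cos x.
  by case: hs => ->; rewrite ?mul1r ?mulN1r ?cosN.
(* What remains is the first equation, up to the sign [s]. *)
have key : (2^-1 - w) + tau * sin phi = - (2^-1 - w') * cos turn + width / 2 * sin turn.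
  apply: (mulIf (lt0r_neq0 cphi)).
  have -> : ((2^-1 - w) + tau * sin phi) * cos phi = (2^-1 - w) * cos phi +
     (width / 2 + (2^-1 - w') * sin turn + width / 2 * cos turn) * sin phi.
    by rewrite /tau; field; rewrite gt_eqF // gt_eqF.
  apply/eqP; rewrite -subr_eq0; apply/eqP.
  transitivity (2^-1 * (cos phi + cos (turn - phi))
     - width / 2 * (sin phi + sin (turn - phi))
     - (w' * cos (turn - phi) - (width * sin phi - w * cos phi))).
    by rewrite cosB sinB; field; rewrite gt_eqF.
  rewrite w'D subrr subr0 tE sinB cosB sinD cosD.
  by field: cos_half_sq cos_half_cube; rewrite gt_eqF.
have t01 := collision_param hs w01.
have t'01 : 0 < 2^-1 + s * (2^-1 - w') < 1 by apply: collision_param => //; rewrite w'0.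
have hE : hit d c (collision i s w phi) = on_side (i + m) (2^-1 + s * (2^-1 - w')).
  have hx (z : R) : 2^-1 + z - 2^-1 = z by ring.
  apply: (@targeted_hit i m _ _ _ tau) => //; first lra.
  - rewrite hcm hsm hsn !hx.
    have -> : s * (2^-1 - w) + tau * (s * sin phi) = s * (2^-1 - w + tau * sin phi) by ring.
    by rewrite key; ring.
  - rewrite hcm hsm hcn !hx divfK ?gt_eqF //.
    have -> : s * (2^-1 - w') * (s * sin turn) = s * s * (2^-1 - w') * sin turn by ring.
    by rewrite hs2; field; rewrite gt_eqF.
  - by rewrite hang cosB cospi sinpi hcn; lra.
exists ((i + m) %% d)%N; split; first by rewrite ltn_mod (leq_trans _ d_ge6).
rewrite (targeted_step _ _ hE) // hang /collision; congr (_, _).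
rewrite sinB cospi sinpi hsn mul0r sub0r mulN1r opprK.
by rewrite asin_sin_sign // ?f_sign //; lra.
Qed.

End Step.

End Geometry.

(** * Convexity of the tangent *)

Section Tangent.
Context (R : realType).
Implicit Types x y t : R.

Lemma tan_slope x y : 0 <= x -> x < y -> y < pi / 2 ->
  exists2 z, x < z < y & tan y - tan x = (cos z ^- 2) * (y - x).
Proof.
move=> x0 xy y1; have hc z : x <= z <= y -> cos z != 0.
  by move=> /andP[h1 h2]; rewrite gt_eqF // cos_gt0_pihalf //; have := pi_gt0 R; lra.
have [z|z|z] := @MVT R tan (fun z => cos z ^- 2) x y xy.
- rewrite in_itv /= => /andP[h1 h2]; apply: is_derive_tan; apply: hc.
  by rewrite !ltW.
- apply: derivable_within_continuous => {}z; rewrite in_itv /= => h.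
  by apply: derivable_tan; exact: hc.
by rewrite in_itv /= => h hE; exists z.
Qed.

Lemma tan_ge0 x : 0 <= x < pi / 2 -> 0 <= tan x.
Proof.
move=> /andP[x0 x1]; have := pi_gt0 R => pi0; rewrite /tan divr_ge0 ?sin_ge0_pi //.
  by lra.
by rewrite ltW // cos_gt0_pihalf //; lra.
Qed.

(** Compare the slopes of the chords of [tan] over [0, k x] and [k x, x]. *)
Lemma tan_scale_lt k x : 0 < k < 1 -> 0 < x < pi / 2 -> tan (k * x) < k * tan x.
Proof.
move=> /andP[k0 k1] /andP[x0 x1].
have kx0 : 0 < k * x by rewrite mulr_gt0.
have kx1 : k * x < x by rewrite gtr_pMl.
have [z /andP[z0 z1]] := tan_slope (lexx 0) kx0 (lt_trans kx1 x1).
rewrite tan0 !subr0 => hz.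
have [y /andP[y0 y1] hy] := tan_slope (ltW kx0) kx1 x1.
have cy : 0 < cos y by apply: cos_gt0_pihalf; lra.
have cz : 0 < cos z by apply: cos_gt0_pihalf; lra.
have cyz : cos y < cos z by rewrite ltr_cos ?in_itv /=; lra.
have hi : cos z ^- 2 < cos y ^- 2.
  by rewrite ltf_pV2 ?posrE ?exprn_gt0 // ltrXn2r // ltW.
rewrite -subr_gt0.
have -> : k * tan x - tan (k * x)
    = k * (tan x - tan (k * x)) - (1 - k) * tan (k * x) by ring.
rewrite hy hz.
have -> : k * (cos y ^- 2 * (x - k * x)) - (1 - k) * (cos z ^- 2 * (k * x))
  = (cos y ^- 2 - cos z ^- 2) * (k * ((1 - k) * x)) by ring.
by rewrite !mulr_gt0 ?subr_gt0.
Qed.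

Lemma tan_scale_le k x : 0 <= k <= 1 -> 0 <= x < pi / 2 -> tan (k * x) <= k * tan x.
Proof.
move=> /andP[k0 k1] /andP[x0 x1].
move: k0 k1 x0; rewrite !le_eqVlt => /orP[/eqP<-|k0]; first by rewrite !mul0r tan0 eqxx.
move=> /orP[/eqP->|k1]; first by rewrite !mul1r eqxx.
move=> /orP[/eqP<-|x0]; first by rewrite mulr0 tan0 mulr0 eqxx.
by rewrite tan_scale_lt ?orbT ?k0 ?x0.
Qed.

Lemma tan_le x y : 0 <= x -> x <= y -> y < pi / 2 -> tan x <= tan y.
Proof.
move=> x0; rewrite le_eqVlt => /orP[/eqP->//|xy] y1.
have pi0 := pi_gt0 R.
by rewrite ltW // ltr_tan // in_itv /=; lra.
Qed.

End Tangent.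

(** * The reflection law *)

Section Law.
Context (R : realType) (k : nat) (f : R -> R).
Context (k_ge1 : (1 <= k)%N) (f_law : contracting_law k f).
Context (f_incr : forall t : R, angles t -> 0 < derive1 f t)
    (f_lambda : (lambda f <= (1 / 2)%:E)%E).

Lemma law_derivable t : angles t -> derivable f t 1.
Proof. by case: f_law => _ [[h _] _ _] _ _ ht; exact: (h 0%N). Qed.

Lemma law_continuous t : angles t -> {for t, continuous f}.
Proof.
by move=> /law_derivable/derivable1_diffP; exact: differentiable_continuous.
Qed.

(** The mean value theorem, with the derivative between 0 and 1/2. *)
Lemma law_slope s t : angles s -> angles t -> s < t ->
  0 < f t - f s <= (t - s) / 2.
Proof.
move=> hs ht st; have hin z : s <= z <= t -> angles z.
  by move: hs ht; rewrite /angles /= !in_itv /= => *; lra.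
have [z|z|z] := @MVT R f (derive1 f) s t st.
- rewrite in_itv /= => /andP[h1 h2]; rewrite derive1E.
  by apply: derivableP; apply: law_derivable; apply: hin; rewrite !ltW.
- apply: derivable_within_continuous => {}z; rewrite in_itv /= => h.
  by apply: law_derivable; exact: hin.
rewrite in_itv /= => /andP[h1 h2] ->.
have hz : angles z by apply: hin; rewrite !ltW.
rewrite mulr_gt0 ?subr_gt0 ?f_incr //= mulrC ler_wpM2l ?subr_ge0 ?(ltW st) //.
have : (`|derive1 f z|%:E <= lambda f)%E by apply: ereal_sup_ubound; exists z.
move=> /le_trans/(_ f_lambda); rewrite lee_fin div1r => /ler_normlW. exact.
Qed.

Lemma law0 : f 0 = 0.
Proof. by case: f_law. Qed.

Lemma angles0 : angles (0 : R).
Proof. by rewrite /angles /= in_itv /=; have := pi_gt0 R; lra. Qed.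

Lemma law_half t : 0 <= t < pi / 2 -> 0 <= f t <= t / 2.
Proof.
move=> /andP[]; rewrite le_eqVlt => /orP[/eqP<-|t0] t1; first by rewrite law0; lra.
have ht : angles t by rewrite /angles /= in_itv /=; lra.
by have := law_slope angles0 ht t0; rewrite law0; lra.
Qed.

Lemma law_norm t : angles t -> `|f t| <= `|t| / 2.
Proof.
move=> ht; have [t0|t0|->] := ltgtP t 0; last by rewrite law0 normr0 mul0r.
  have := law_slope ht angles0 t0; rewrite law0 => h.
  by rewrite (ltr0_norm t0) ltr0_norm; lra.
have := law_slope angles0 ht t0; rewrite law0 => h.
by rewrite (gtr0_norm t0) gtr0_norm; lra.
Qed.

Section Turn.
Context (a : R) (a_gt0 : 0 < a) (a_le : a <= pi / 3).
Context (f_star : forall delta : R,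
  0 <= delta <= 1 -> f (delta * a) <= delta * f a).

Notation mu := (f a / a).

Lemma law_ratio : 0 < mu <= 2^-1.
Proof.
have pi0 := pi_gt0 R; have a0 := a_gt0; have a1 := a_le.
have ha : angles a by rewrite /angles /= in_itv /=; lra.
have := law_slope angles0 ha a_gt0; rewrite law0 !subr0 => /andP[h1 h2].
by rewrite divr_gt0 //= ler_pdivrMr // mulrC.
Qed.

(** Here the hypothesis that [f] lies below its chord enters. *)
Lemma law_le_ratio t : 0 <= t <= a -> f t <= mu * t.
Proof.
move=> /andP[t0 ta]; rewrite -{1}(divfK (lt0r_neq0 a_gt0) t).
have -> : mu * t = t / a * f a by ring.
apply: f_star.
by rewrite divr_ge0 ?(ltW a_gt0) //= ler_pdivrMr // mul1r.
Qed.

(** After an exit with angle [phi] and the second exit, with angle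
    [f (a - phi)], the left-hand side is the drift per unit of width of the
    next flight, and the factor of [1 - mu] a lower bound for the room per
    unit of width: the term [sin phi / cos (a - phi)] accounts for the
    distance from the vertex at which the first exit lands. At [phi = 0] the
    inequality follows from [f (a - f a) <= (1 - mu) * f a] and strict convexity
    of [tan]; continuity gives it nearby. *)
Lemma exit_margin : exists2 eps, 0 < eps & forall phi, 0 <= phi < eps ->
  tan (f (a - f (a - phi)))
    < (1 - mu) * (tan (f (a - phi)) - sin phi / cos (a - phi)).
Proof.
have pi0 := pi_gt0 R; have a0 := a_gt0; have a1 := a_le.
pose F phi := (1 - mu) * (tan (f (a - phi)) - sin phi / cos (a - phi))
               - tan (f (a - f (a - phi))).
have [mu0 mu1] := andP law_ratio.
have fa : 0 < f a <= a / 2.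
  have ha : angles a by rewrite /angles /= in_itv /=; lra.
  by have := law_slope angles0 ha a_gt0; rewrite law0 !subr0.
have hffa : 0 <= f (a - f a) <= (1 - mu) * f a.
  have /andP[-> _] : 0 <= f (a - f a) <= (a - f a) / 2 by apply: law_half; lra.
  have := @law_le_ratio (a - f a).
  have -> : mu * (a - f a) = (1 - mu) * f a by field; rewrite gt_eqF.
  by apply; lra.
have F0 : 0 < F 0.
  rewrite /F subr0 sin0 mul0r subr0 subr_gt0.
  apply: (@le_lt_trans _ _ (tan ((1 - mu) * f a))).
    have hm : 0 <= mu * f a by rewrite mulr_ge0; lra.
    by apply: tan_le; lra.
  by apply: tan_scale_lt; lra.
have cpos (t : R) : 0 <= t <= pi / 3 -> cos t != 0.
  by move=> h; rewrite gt_eqF // cos_gt0_pihalf //; lra.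
have c1 : (a - x) @[x --> (0 : R)] --> a - 0.
  by apply: cvgB; [exact: cvg_cst|exact: cvg_id].
have c2 : f (a - x) @[x --> (0 : R)] --> f (a - 0).
  apply: continuous_cvg c1; apply: law_continuous.
  by rewrite subr0 /angles /= in_itv /=; lra.
have c3 : f (a - f (a - x)) @[x --> (0 : R)] --> f (a - f (a - 0)).
  apply: continuous_cvg; last by apply: cvgB; [exact: cvg_cst|exact: c2].
  by apply: law_continuous; rewrite subr0 /angles /= in_itv /=; lra.
have k1 : cos (a - 0) != 0 by rewrite subr0; apply: cpos; lra.
have k2 : cos (f (a - 0)) != 0 by rewrite subr0; apply: cpos; lra.
have k3 : cos (f (a - f (a - 0))) != 0.
  have hm : 0 <= mu * f a by rewrite mulr_ge0; lra.
  by rewrite subr0; apply: cpos; lra.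
have hc : F x @[x --> (0 : R)] --> F 0.
  apply: cvgB; last first.
    by apply: continuous_cvg c3; exact: continuous_tan.
  apply: cvgM; first exact: cvg_cst.
  apply: cvgB.
    by apply: continuous_cvg c2; exact: continuous_tan.
  apply: cvgM; first exact: continuous_sin.
  apply: cvgV; first exact: k1.
  by apply: continuous_cvg c1; exact: continuous_cos.
have : \forall x \near (0 : R), 0 < F x by apply: cvgr_gt hc _ F0.
move=> [eps /= eps0 heps]; exists eps => // phi /andP[p0 p1].
have := heps phi; rewrite /= sub0r normrN ger0_norm // => /(_ p1).
by rewrite subr_gt0.
Qed.

End Turn.
End Law.

(** * Trapped orbits *)

Section Dynamics.
Context (R : realType) (d : nat) (c : nat -> R * R) (k : nat) (f : R -> R).
Context (d_ge6 : (6 <= d)%N) (Preg : regular_polygon d c) (d_even : ~~ odd d)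
    (k_ge1 : (1 <= k)%N) (f_law : contracting_law k f)
    (f_odd : forall t : R, angles t -> f (- t) = - f t)
    (f_incr : forall t : R, angles t -> 0 < derive1 f t)
    (f_lambda : (lambda f <= (1 / 2)%:E)%E)
    (f_star : forall delta : R, 0 <= delta <= 1 ->
       f (delta * (2 * pi / d%:R)) <= delta * f (2 * pi / d%:R)).

Notation turn := (2 * pi / d%:R : R).
Notation half := (pi / d%:R : R).
Notation width := (cos half / sin half).
Notation mu := (f turn / turn).
Notation Phi := (billiard_map d c f).

Let f_angles : forall t, @angles R t -> angles (f t).
Proof. by case: f_law. Qed.

Lemma turn_gt0 : 0 < turn.
Proof. have h := half_turn_gt0 R d_ge6; have -> := turn2 R d_ge6; lra. Qed.

Lemma width_gt0 : 0 < width.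
Proof. by apply: divr_gt0; [exact: cos_half_gt0|exact: sin_half_gt0]. Qed.

Lemma width_tan_half : width * tan half = 1.
Proof.
rewrite /tan; have := sin_half_gt0 R d_ge6; have := cos_half_gt0 R d_ge6 => h1 h2.
by field; rewrite !gt_eqF.
Qed.

(** A flight with angle [pi / d] crosses the strip between two parallel sides
    diagonally. *)
Lemma lt_half phi : 0 <= phi < pi / 2 -> width * tan phi < 1 -> phi < half.
Proof.
move=> h h1; rewrite ltNge; apply/negP => h2.
have := @tan_le R half phi (ltW (half_turn_gt0 R d_ge6)) h2 (andP h).2.
by rewrite leNgt => /negP; apply; rewrite -(ltr_pM2l width_gt0) width_tan_half.
Qed.

(** The room [w] suffices for all the drift to come, bounded by the geometric
    series [width * tan phi * (1 + mu + mu ^ 2 + ...)]. *)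
Definition trapped (z : R * R) := exists i s w phi,
  [/\ s = 1 \/ s = - 1, 0 < w < 1, 0 <= phi < pi / 2,
      width * tan phi < (1 - mu) * w & z = collision i s w phi].

Definition angle_halved (z : R * R) := `|(Phi z).2| <= `|z.2| / 2.

Lemma collision_norm i s w (phi : R) : s = 1 \/ s = - 1 -> 0 <= phi ->
  `|(collision i s w phi).2| = phi.
Proof.
by move=> hs p0; case: hs => -> /=; rewrite ?mul1r ?mulN1r ?normrN ger0_norm.
Qed.

Lemma sgnN (s : R) : s = 1 \/ s = - 1 -> - s = 1 \/ - s = - 1.
Proof. by case=> ->; [right|left; rewrite opprK]. Qed.

Lemma parallel_halves i s w phi : s = 1 \/ s = - 1 -> 0 < w < 1 ->
  0 <= phi < pi / 2 -> width * tan phi < w -> angle_halved (collision i s w phi).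
Proof.
move=> hs w01 hphi hw.
have [f0 f1] := andP (law_half k_ge1 f_law f_incr f_lambda hphi).
rewrite /angle_halved (parallel_step d_ge6 Preg d_even f_odd) ?subr_gt0 //.
by rewrite (collision_norm _ _ (sgnN hs) f0) (collision_norm _ _ hs (andP hphi).1).
Qed.

(** A flight uses [width * tan phi] of the room, and the next one needs at most
    [mu] times as much, as [tan (f phi) <= tan (mu * phi) <= mu * tan phi]. *)
Lemma trapped_step z : trapped z -> trapped (Phi z) /\ angle_halved z.
Proof.
move=> [i [s [w [phi [hs w01 hphi htr ->]]]]].
have [mu0 mu1] := andP
  (law_ratio k_ge1 f_law f_incr f_lambda turn_gt0 (turn_le R d_ge6)).
have [w0 w1] := andP w01; have [p0 p1] := andP hphi; have W0 := width_gt0.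
have hm : 0 < mu * w by rewrite mulr_gt0.
have t0 := tan_ge0 hphi.
have Wt : 0 <= width * tan phi by rewrite mulr_ge0 // ltW.
have hw : width * tan phi < w by lra.
split; last exact: parallel_halves.
have [f0 f1] := andP (law_half k_ge1 f_law f_incr f_lambda hphi).
rewrite (parallel_step d_ge6 Preg d_even f_odd) ?subr_gt0 //.
exists ((i + d./2) %% d)%N, (- s), (w - width * tan phi), (f phi).
split=> //; [exact: sgnN|lra|lra|].
have hh : phi < half by apply: lt_half => //; lra.
have tE := turn2 R d_ge6.
have h1 : f phi <= mu * phi.
  by apply: law_le_ratio => //; [exact: turn_gt0|rewrite p0 tE /=; lra].
have mp : mu * phi <= 1 * phi by rewrite ler_wpM2r //; lra.
have h2 : tan (f phi) <= mu * tan phi.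
  apply: le_trans (tan_scale_le _ hphi); last lra.
  by apply: tan_le => //; lra.
have h3 : width * tan (f phi) <= width * (mu * tan phi) by rewrite ler_wpM2l // ltW.
lra.
Qed.

Lemma trapped_iter z n : trapped z -> trapped (iter n Phi z).
Proof. by move=> h; elim: n => // n IH; have [] := trapped_step IH. Qed.

Lemma exit_coord_gt0 w phi : 0 <= phi < half -> w < width * tan phi ->
  0 < (width * sin phi - w * cos phi) / cos (turn - phi).
Proof.
move=> /andP[p0 p1] hw; have pi0 := pi_gt0 R; have t3 := turn_le R d_ge6.
have tE := turn2 R d_ge6; have h0 := half_turn_gt0 R d_ge6.
rewrite divr_gt0 ?cos_gt0_pihalf //; last by lra.
have c0 : 0 < cos phi by apply: cos_gt0_pihalf; lra.
by rewrite subr_gt0 -ltr_pdivlMr // -[X in _ < X]mulrA.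
Qed.

(** The first exit lands close to a vertex towards which the next flight, with
    angle [phi1], drifts; so this flight exits as well, and [exit_margin]
    compares the room that it finds with the new angle [phi2]. *)
Lemma exit_twice : exists2 eps, 0 < eps & forall i s w phi,
  s = 1 \/ s = - 1 -> 0 < w < 1 -> 0 <= phi < eps -> w < width * tan phi ->
  trapped (Phi (Phi (collision i s w phi))).
Proof.
have [eps0 eps0_gt0 margin] :=
  exit_margin k_ge1 f_law f_incr f_lambda turn_gt0 (turn_le R d_ge6) f_star.
have [mu0 mu1] := andP
  (law_ratio k_ge1 f_law f_incr f_lambda turn_gt0 (turn_le R d_ge6)).
have h0 := half_turn_gt0 R d_ge6; have tE := turn2 R d_ge6; have pi0 := pi_gt0 R.
have t3 := turn_le R d_ge6; have W0 := width_gt0.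
exists (Num.min eps0 half); first by rewrite lt_min eps0_gt0.
move=> i s w phi hs w01 /andP[p0]; rewrite lt_min => /andP[p1 p2] hw.
have hphi : 0 <= phi < half by rewrite p0.
have pp : 0 < phi.
  (* With angle 0 there is no drift, hence no exit. *)
  rewrite lt_neqAle p0 andbT; apply: contraTneq hw => <-.
  by rewrite tan0 mulr0 -leNgt; case/andP: w01 => /ltW.
have [j [_ ->]] := exit_step d_ge6 Preg d_even f_odd i hs w01 hphi hw.
have := margin phi; rewrite p0 p1 => /(_ isT).
set phi1 := f (turn - phi); set phi2 := f (turn - phi1) => hmar.
have w1_gt0 := exit_coord_gt0 hphi hw.
have w1_lt1 := exit_coord_lt1 d_ge6 (andP w01).1 hphi.
set w1 := _ / cos _ in w1_gt0 w1_lt1 *.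
have hphi1 : 0 <= phi1 <= (turn - phi) / 2.
  by apply: (law_half k_ge1 f_law f_incr f_lambda); lra.
have hphi1' : 0 <= phi1 < half by rewrite tE in hphi1; lra.
have hphi2 : 0 <= phi2 <= (turn - phi1) / 2.
  by apply: (law_half k_ge1 f_law f_incr f_lambda); lra.
have D0 : 0 < cos (turn - phi) by apply: cos_gt0_pihalf; lra.
have D1 : 0 < cos (turn - phi1) by apply: cos_gt0_pihalf; lra.
have c1 : 0 < cos phi1 by apply: cos_gt0_pihalf; lra.
have t2 : 0 <= tan phi2 by apply: tan_ge0; lra.
have hw1 : w1 <= width * (sin phi / cos (turn - phi)).
  rewrite mulrA ler_pM2r ?invr_gt0 // gerBl mulr_ge0 //.
    by case/andP: w01 => /ltW.
  by rewrite ltW // cos_gt0_pihalf //; lra.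
have hmar' : sin phi / cos (turn - phi) < tan phi1.
  rewrite -subr_gt0 -(@pmulr_rgt0 _ (1 - mu)); last lra.
  exact: le_lt_trans hmar.
have hw1' : w1 < width * tan phi1 by apply: le_lt_trans hw1 _; rewrite ltr_pM2l.
have w1_01 : 0 < w1 < 1 by rewrite w1_gt0.
have [j2 [_ ->]] := exit_step d_ge6 Preg d_even f_odd j hs w1_01 hphi1' hw1'.
have w2_gt0 := exit_coord_gt0 hphi1' hw1'.
have w2_lt1 := exit_coord_lt1 d_ge6 w1_gt0 hphi1'.
exists j2, s, ((width * sin phi1 - w1 * cos phi1) / cos (turn - phi1)), phi2.
split; [exact: hs| by rewrite w2_gt0 w2_lt1|lra| |reflexivity].
have hc : cos (turn - phi1) <= cos phi1.
  by rewrite ltW // ltr_cos ?in_itv /=; lra.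
have w2E : (width * sin phi1 - w1 * cos phi1) / cos (turn - phi1)
   = (width * tan phi1 - w1) * (cos phi1 / cos (turn - phi1)).
  rewrite /tan; have S0 := sin_half_gt0 R d_ge6; by field; rewrite !gt_eqF.
rewrite w2E.
apply: (@lt_le_trans _ _ ((1 - mu) * (width * tan phi1 - w1))); last first.
  rewrite ler_wpM2l //; first lra.
  by rewrite ler_peMr ?subr_ge0 ?(ltW hw1') // ler_pdivlMr // mul1r.
apply: (@lt_le_trans _ _ (width * ((1 - mu) * (tan phi1 - sin phi / cos (turn - phi))))).
  by rewrite ltr_pM2l.
rewrite mulrCA ler_wpM2l //; first lra.
by rewrite mulrBr lerB.
Qed.


(** * Long runs between parallel sides *)

Lemma regular_iter x n : regular_points d c f x ->
  regular_points d c f (iter n Phi x).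
Proof. by move=> hx; elim: n => // n IH; exact: (regular_step d_ge6 Preg d_even). Qed.

Lemma regular_phase x : regular_points d c f x -> (phase d `\` vertex_lines d) x.
Proof. by move=> /regular_dom/(billiard_domP d_ge6 Preg)[]. Qed.

Lemma collisionP (x : R * R) : (phase d `\` vertex_lines d) x ->
  exists i s w phi, [/\ s = 1 \/ s = - 1, 0 < w < 1, 0 <= phi < pi / 2,
    phi = `|x.2| & x = collision i s w phi].
Proof.
move=> /phase_sideP[i [t [id' t01 hth ->]]] /=.
move: (x.2) hth => th; rewrite /angles /= in_itv /= => hth.
have [th0|th0] := leP 0 th.
  exists i, 1, (1 - t), th; split; [by left|lra|lra|by rewrite ger0_norm|].
  by rewrite /collision; congr (_ + _, _); lra.
exists i, (- 1), t, (- th); split; [by right|lra|lra|by rewrite ltr0_norm|].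
by rewrite /collision; congr (_ + _, _); lra.
Qed.

(** Consider the first collision at which the angle is not halved. There the room
    is insufficient for a flight to the parallel side, so the orbit exits, the
    angle still being small, and is trapped two collisions later. *)
Lemma small_angle_eventually_halved : exists2 eps, 0 < eps & forall x,
  regular_points d c f x -> `|x.2| < eps ->
  exists N, forall n, (N <= n)%N -> angle_halved (iter n Phi x).
Proof.
have [eps eps0 exit2] := exit_twice.
exists eps => // x hx xeps.
have [h|] := pselect (forall n, angle_halved (iter n Phi x)); first by exists 0%N.
move=> /existsNP hex.
have /ex_minnP[n /asboolP hn hmin] : exists n, `[< ~ angle_halved (iter n Phi x) >].
  by case: hex => n hn; exists n; apply/asboolP.
have hcon m : (m < n)%N -> angle_halved (iter m Phi x).
  move=> mn; apply: contrapT => h; have := hmin m; rewrite leqNgt mn.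
  by move=> H; have := H (asboolT h).
have hang m : (m <= n)%N -> `|(iter m Phi x).2| <= `|x.2|.
  elim: m => // m IH mn; apply: le_trans (hcon m mn) _.
  have := IH (ltnW mn); have := normr_ge0 (iter m Phi x).2; lra.
have hz := regular_iter n hx; have hzeps := le_lt_trans (hang n (leqnn n)) xeps.
have [i [s [w [phi [hs w01 hphi phiE zE]]]]] := collisionP (regular_phase hz).
exists n.+2 => m nm.
have : trapped (iter n.+2 Phi x).
  rewrite 2!iterS zE; apply: exit2 => //; first by rewrite (andP hphi).1 phiE.
  rewrite ltNge le_eqVlt; apply/negP => /orP[/eqP hw|hw]; last first.
    by apply: hn; rewrite zE; exact: (parallel_halves).
  (* If the drift brings the orbit exactly to the end of the side, the flight
     ends in a vertex, which a regular point excludes. *)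
  have [_ hcorner] := billiard_domP d_ge6 Preg (regular_dom hz).
  have := parallel_hit d_ge6 Preg d_even i hs w01 hphi.
  rewrite hw subrr subr0 lexx => /(_ isT).
  rewrite -zE; case: hs => ->.
    by rewrite mul1r subrr on_side0; exact: hcorner.
  rewrite mulN1r opprK; have -> : 2^-1 + 2^-1 = 1 :> R by field.
  by rewrite on_side1; exact: hcorner.
rewrite -(subnK nm) iterD => /(trapped_iter) h.
by have [] := trapped_step (h (m - n.+2)%N).
Qed.

(** Only the directions of the sides enter: a flight between parallel sides
    arrives with the angle with which it left, up to sign. *)
Lemma parallel_sides_halve x : billiard_dom d c x ->
  between_parallel_sides d c f x -> angle_halved x.
Proof.
move=> hx.
have [/phase_sideP[i [t [id' t01 hth xE]]] _] := billiard_domP d_ge6 Preg hx.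
rewrite /between_parallel_sides /angle_halved /side_index.
have [j [t' [jd t'01 hj ->]]] := billiard_step d_ge6 Preg d_even f hx.
rewrite [in x.1]xE /= !truncn_side; [|lra|lra].
have -> : velocity c x = sin x.2 *: side c i + cos x.2 *: perp (side c i).
  by rewrite [in LHS]xE velocityE.
move=> hc; set th := x.2 in hth *.
have hi := dot_side Preg i; have hj1 := dot_side Preg j.
have dE : dot (side c j) (sin th *: side c i + cos th *: perp (side c i))
   = sin th * dot (side c j) (side c i) + cos th * cross (side c i) (side c j).
  by move: (side c i) (side c j) => u v; coords; ring.
have hd : (dot (side c j) (side c i)) ^+ 2 = 1.
  transitivity (dot (side c i) (side c i) * dot (side c j) (side c j)
      - (cross (side c i) (side c j)) ^+ 2).
    by move: (side c i) (side c j) => u v; coords; ring.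
  by rewrite hi hj1 hc; ring.
rewrite dE hc mulr0 addr0.
have hasin : asin (sin th) = th.
  rewrite sinK // in_itv /=; move: hth.
  by rewrite /angles /= in_itv /= => /andP[/ltW -> /ltW ->].
have hlaw := law_norm k_ge1 f_law f_incr f_lambda.
move/eqP: hd; rewrite sqrf_eq1 => /orP[] /eqP ->.
  by rewrite mulr1 hasin; exact: hlaw.
rewrite mulrN1 -sinN sinK; last first.
  rewrite in_itv /=; move: hth; rewrite /angles /= in_itv /= => /andP[h1 h2].
  by apply/andP; split; lra.
rewrite -[X in _ <= X / _]normrN; apply: hlaw.
by move: hth; rewrite /angles /= !in_itv /= => /andP[h1 h2]; apply/andP; split; lra.
Qed.

Lemma on_side_not_vertex j t m : 0 < t < 1 -> on_side c j t <> c m.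
Proof.
move=> t01 h; have jm : (m %% d = j %% d)%N.
  apply/eqP; apply: contraT => mj.
  have := gap_on_side_gt0 d_ge6 Preg t01 mj.
  by rewrite h -(on_side0 c m) (gap_on_own_side d_ge6 Preg) ltxx.
have := t01; rewrite (@on_side_inj _ _ _ Preg j t 0) ?ltxx //.
rewrite h -(on_side0 c m) -(on_side_mod Preg m) -(on_side_mod Preg j).
by rewrite jm.
Qed.

Lemma signed_parallel_hit i (t th : R) : 0 < t < 1 -> angles th ->
  0 < t + width * tan th < 1 ->
  hit d c (i%:R + t, th) = on_side c (i + d./2) (1 - (t + width * tan th)).
Proof.
move=> t01; rewrite /angles /= in_itv /= => hth ht.
have [th0|th0] := leP 0 th.
  have := @parallel_hit R d c d_ge6 Preg d_even i 1 (1 - t) th (or_introl erefl).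
  rewrite /collision !mul1r.
  have -> : 2^-1 + (2^-1 - (1 - t)) = t by field.
  move=> ->; [congr on_side; field|lra|lra|lra].
  by rewrite gt_eqF // sin_half_gt0.
have := @parallel_hit R d c d_ge6 Preg d_even i (- 1) t (- th) (or_intror erefl).
rewrite /collision !mulN1r opprK tanN.
have -> : 2^-1 + - (2^-1 - t) = t by ring.
move=> ->; [congr on_side; field|lra|lra|lra].
by rewrite gt_eqF // sin_half_gt0.
Qed.

(** A flight perpendicular to its side ends inside the parallel side, and so do
    the flights nearby, which keeps the point away from the closure in
    [corner_set]. *)
Lemma perpendicular_dom i (t : R) : (i < d)%N -> 0 < t < 1 ->
  billiard_dom d c (i%:R + t, 0).
Proof.
move=> id' t01; have [hp hv] := side_phase id' t01 (angles0 R).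
set z : R * R := (i%:R + t, 0).
have near1 a b : a < z.1 < b -> \forall y \near z, a < y.1 < b.
  move=> h; have hN : \forall s \near z.1, a < s < b.
    have : z.1 \in `]a, b[ by rewrite in_itv.
    by move=> /near_in_itvoo; apply: filterS => s; rewrite in_itv.
  exact: (@cvg_fst R R (nbhs z.1) (nbhs z.2) _ _ hN).
have near2 : \forall y \near z, angles y.2.
  have : (0 : R) \in `]- (pi / 2), pi / 2[ by exact: (angles0 R).
  by move=> /near_in_itvoo; exact: (@cvg_snd R R (nbhs z.1) (nbhs z.2) _).
split=> // -[[[_]|//]|[m _ hcl]].
  apply; have [+ _] := hp; rewrite /= in_itv /= => /near1 h.
  by apply: filterS (filterI h near2) => y [hy1 hy2]; split.
have h1 : \forall y \near z, i%:R < y.1 < i%:R + 1 by apply: near1; rewrite /=; lra.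
have h3 : \forall y \near z, 0 < (y.1 - i%:R) + width * tan y.2 < 1.
  have hc : (y.1 - i%:R) + width * tan y.2 @[y --> z]
      --> (z.1 - i%:R) + width * tan z.2.
    apply: cvgD; first by apply: cvgB; [exact: cvg_fst|exact: cvg_cst].
    apply: cvgM; first exact: cvg_cst.
    apply: continuous_cvg; last exact: cvg_snd.
    by apply: continuous_tan; rewrite /= cos0 oner_neq0.
  have zE : z.1 - i%:R + width * tan z.2 = t by rewrite /= tan0 mulr0; ring.
  rewrite zE in hc.
  have g0 := cvgr_gt _ hc 0 (andP t01).1; have g1 := cvgr_lt _ hc 1 (andP t01).2.
  near=> y; apply/andP; split.
    by near: y; exact: g0.
 by near: y; exact: g1.
have [y [[_ hit_y] [[h4 h5] h6]]] := hcl _ (filterI (filterI h1 near2) h3).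
have yE : y = (i%:R + (y.1 - i%:R), y.2) by case: (y) => ? ? /=; congr (_, _); ring.
have {}h4 : 0 < y.1 - i%:R < 1 by lra.
move: hit_y; rewrite yE (signed_parallel_hit _ h4 h5 h6).
by apply: on_side_not_vertex; lra.
Unshelve. all: by end_near.
Qed.

Lemma perpendicular_step i (t : R) : 0 < t < 1 ->
  Phi (i%:R + t, 0) = (((i + d./2) %% d)%N%:R + (1 - t), 0).
Proof.
move=> t01; have := parallel_step d_ge6 Preg d_even f_odd i (or_introl erefl)
  (w := 1 - t) (phi := 0).
rewrite /collision !mul1r tan0 mulr0 subr0 (law0 f_law) mulr0 => h.
have e1 : t = 2^-1 + (2^-1 - (1 - t)) by field.
rewrite {1}e1 h; [congr (_ + _, _); ring|lra| |lra].
by rewrite lexx divr_gt0 ?pi_gt0.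
Qed.

Lemma perpendicular_period_two i (t : R) : (i < d)%N -> 0 < t < 1 ->
  period_two d c f (i%:R + t, 0).
Proof.
move=> id' t01; have t01' : 0 < 1 - t < 1 by lra.
have d0 : (0 < d)%N by exact: leq_trans d_ge6.
have jd : ((i + d./2) %% d < d)%N by rewrite ltn_mod.
have hd := even_halfK d_even; have d6 := d_ge6.
have hji : ((i + d./2) %% d + d./2 = i %[mod d])%N.
  by rewrite modnDml -addnA addnn hd modnDr.
split; rewrite ?perpendicular_step //; try exact: perpendicular_dom.
  move=> [] hE; have := congr1 Num.truncn hE.
  rewrite !truncn_side; [|lra|lra] => hi.
  have := hji; rewrite hi => /eqP; rewrite -[X in _ == X %[mod d]]addn0.
  by rewrite eqn_modDl mod0n modn_small; lia.
rewrite hji modn_small //; congr (_ + _, _); ring.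
Qed.

Lemma edist_period_two x : (phase d `\` vertex_lines d) x ->
  (Defs.edist x (period_two d c f) <= `|x.2|%:E)%E.
Proof.
move=> /phase_sideP[i [t [id' t01 hth xE]]].
apply: ereal_inf_lbound; exists (i%:R + t, 0); first exact: perpendicular_period_two.
by rewrite xE /enorm /dot /= subrr subr0 mulr0 add0r -expr2 sqrtr_sqr.
Qed.

(** The distance to the points of period two is at most the size of the angle,
    which decreases geometrically. *)
Lemma halving_basin x : regular_points d c f x ->
  (exists N, forall n, (N <= n)%N -> angle_halved (iter n Phi x)) ->
  basin d c f (period_two d c f) x.
Proof.
move=> hx [N hN]; split=> //.
have hgeo n : `|(iter (n + N) Phi x).2| <= geometric `|(iter N Phi x).2| 2^-1 n.
  elim: n => [|n IH]; first by rewrite /geometric /= expr0 mulr1.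
  rewrite addSn iterS; apply: le_trans (hN _ (leq_addl n N)) _.
  by move: IH; rewrite /geometric /= exprS; lra.
rewrite -(cvg_shiftn N).
have low : (fun=> 0%E : \bar R) @ \oo --> (0%E : \bar R) by exact: cvg_cst.
have up : (geometric `|(iter N Phi x).2| 2^-1 n)%:E @[n --> \oo] --> (0%E : \bar R).
  apply: cvg_EFin; first exact: nearW.
  by apply: cvg_geometric; rewrite ger0_norm; lra.
apply: squeeze_cvge low up; apply: nearW => n; apply/andP; split.
  by apply: le_ereal_inf_tmp => _ [p _ <-]; rewrite lee_fin sqrtr_ge0.
apply: le_trans (edist_period_two (regular_phase (regular_iter _ hx))) _.
by rewrite lee_fin.
Qed.

(** Along the run the angle is at least halved at each collision, starting
    below [pi / 2], so [N] is such that [pi / 2 * 2^-N] is small enough for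
    [small_angle_eventually_halved]. *)
Lemma long_parallel_run_basin : exists N : nat, forall (x : R * R) (n : nat),
  (N < n)%N -> regular_points d c f x -> consecutive_parallel d c f x n ->
  orbit_of d c f x `<=` basin d c f (period_two d c f).
Proof.
have [eps eps0 small] := small_angle_eventually_halved.
have pi0 := pi_gt0 R.
have [N hN] : exists N, geometric (pi / 2) 2^-1 N < eps.
  have h : geometric (pi / 2) 2^-1 n @[n --> \oo] --> (0 : R).
    by apply: cvg_geometric; rewrite ger0_norm; lra.
  have [N _ hN] := cvgr_lt _ h _ eps0.
  by exists N; apply: (hN N) => /=.
exists N => x n Nn hx [m hm] _ [l _ <-].
have hang j : (j <= n)%N -> `|(iter (m + j) Phi x).2| <= geometric (pi / 2) 2^-1 j.
  elim: j => [_|j IH jn].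
    rewrite addn0 /geometric /= expr0 mulr1.
    have [[_ + ] _] := regular_phase (regular_iter m hx).
    by rewrite /angles /= in_itv /= ler_norml => /andP[/ltW -> /ltW ->].
  rewrite addnS iterS.
  have := parallel_sides_halve (regular_dom (regular_iter (m + j) hx)) (hm j jn).
  by rewrite /angle_halved; move: (IH (ltnW jn)); rewrite /geometric /= exprS; lra.
have [M hM] := small _ (regular_iter (m + N) hx) (le_lt_trans (hang N (ltnW Nn)) hN).
apply: halving_basin; first exact: regular_iter.
exists (M + (m + N))%N => j hj; rewrite -iterD.
have -> : (j + l = (j + l - (m + N)) + (m + N))%N by lia.
by rewrite iterD; apply: hM; lia.
Qed.

End Dynamics.

Theorem proposition6p5 (R : realType) (d : nat) (c : nat -> R * R)
    (k : nat) (f : R -> R)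
    (d_even : ~~ odd d) (d_ge6 : (6 <= d)%N)
    (Preg : regular_polygon d c)
    (k_ge1 : (1 <= k)%N)
    (f_law : contracting_law k f)
    (f_odd : forall t : R, angles t -> f (- t) = - f t)
    (f_incr : forall t : R, angles t -> 0 < derive1 f t)
    (f_lambda : (lambda f <= (1 / 2)%:E)%E)
    (f_star : forall delta : R, 0 <= delta <= 1 ->
       f (delta * (2 * pi / d%:R)) <= delta * f (2 * pi / d%:R)) :
  exists C : R, 0 < C /\
    forall x : R * R, regular_points d c f x ->
      (exists n : nat, C < n%:R /\ consecutive_parallel d c f x n) ->
      orbit_of d c f x `<=` basin d c f (period_two d c f).
Proof.
have [N hN] := long_parallel_run_basin d_ge6 Preg d_even k_ge1 f_law f_odd
  f_incr f_lambda f_star.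
exists N.+1%:R; split=> [|x hx [n [Nn hn]]]; first by rewrite ltr0n.
by apply: hN hx hn; rewrite ltnW // -(ltr_nat R).
Qed.
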